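(* Let $X$ be the Chamanara surface. For every $d\in\mathbb{N}=\{1,2,\dots\}$, there exists a finite abelian cover of $X$ with $d$ ends. More specifically, for an abelian group $G$ of order $d$ and $h\in\mathcal{B}_G$, the cover $Y_h$ has $d$ ends if and only if there exists an $N\in\mathbb{N}$ such that $\sum_{k=-N}^{N-1}(-1)^k h_k=0$ and $h_{-n}=h_{-N}=h_N=h_n$ for all $n\ge N$.
   Context: Chamanara surface: take the open unit square $(0,1)^2$ and, for each $n\ge 1$, add open boundary segments and glue them by translations: the left segment $\{0\}\times(1-2^{1-n},1-2^{-n})$ is glued to the right segment $\{1\}\times(2^{-n},2^{1-n})$, giving a vertical segment $a_n$; the bottom segment $(1-2^{1-n},1-2^{-n})\times\{0\}$ is glued to the top segment $(2^{-n},2^{1-n})\times\{1\}$, giving a horizontal segment $b_n$. The result $X$ (endpoints of segments and corners not included) is a translation surface. Fundamental group: let $x$ be the midpoint of the square. For $i\ge1$ let $\alpha_i$ be the closed curve at $x$ that crosses $a_i$ once from left to right (leaving the square through the right side, re-entering through the left side) and $\beta_i$ the closed curve at $x$ that crosses $b_i$ once from top to bottom (leaving through the bottom side, re-entering through the top side), with no other intersections with the boundary of the square. The group $\pi_1(X,x)$ is free on all $\alpha_i,\beta_i$, $i\ge 1$. Covers and defining vectors: covers are connected; a finite abelian cover is a normal covering with finite abelian deck group. For a group $G$ (written additively), $\mathcal{B}_G=\{(h_i)\in G^{\mathbb{Z}} : \langle h_i\mid i\in\mathbb{Z}\rangle=G,\ h_0=0\}$. For $h\in\mathcal{B}_G$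 let $\kappa_h:\pi_1(X,x)\to G$ be the surjective homomorphism with $\kappa_h(\alpha_i)=h_i$, $\kappa_h(\beta_i)=h_{-i}$ ($i\ge 1$); $Y_h\to X$ is the normal covering with deck group $G$ corresponding to $\ker\kappa_h$. Ends are topological ends of the surface. *)

(* Defs.v *)
From Stdlib Require Import Relations.
From HB Require Import structures.
From mathcomp Require Import all_boot all_order all_fingroup all_algebra.
From mathcomp Require Import all_classical all_reals all_analysis.

Set Implicit Arguments.
Unset Strict Implicit.
Unset Printing Implicit Defensive.

Import Order.TTheory GRing.Theory Num.Theory.
Import numFieldNormedType.Exports.

Local Open Scope classical_set_scope.
Local Open Scope ring_scope.

Section Chamanara.
Variable R : realType.

Definition open_square : set (R * R) :=
  [set p | 0 < p.1 < 1 /\ 0 < p.2 < 1].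

(* The segments below are meant for [1 <= n], so that [2 ^- n.-1] is
   2^(1 - n). *)
Definition left_segment n : set (R * R) :=
  [set p | p.1 = 0 /\ 1 - 2 ^- n.-1 < p.2 < 1 - 2 ^- n].
Definition right_segment n : set (R * R) :=
  [set p | p.1 = 1 /\ 2 ^- n < p.2 < 2 ^- n.-1].
Definition bottom_segment n : set (R * R) :=
  [set p | p.2 = 0 /\ 1 - 2 ^- n.-1 < p.1 < 1 - 2 ^- n].
Definition top_segment n : set (R * R) :=
  [set p | p.2 = 1 /\ 2 ^- n < p.1 < 2 ^- n.-1].

Definition polygon : set (R * R) :=
  open_square `|`
  \bigcup_(n in [set n | (1 <= n)%N])
    (left_segment n `|` right_segment n `|`
     (bottom_segment n `|` top_segment n)).

Definition glued (p q : R * R) : Prop :=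
  exists2 n, (1 <= n)%N &
    [/\ left_segment n p, right_segment n q &
        q = p + (1, 2 ^- n - (1 - 2 ^- n.-1))] \/
    [/\ bottom_segment n p, top_segment n q &
        q = p + (2 ^- n - (1 - 2 ^- n.-1), 1)].

Definition glued_polygon (p q : polygon) : Prop :=
  glued (set_val p) (set_val q).

Definition same_point (p q : polygon) : bool :=
  `[< clos_refl_sym_trans polygon glued_polygon p q >].

Lemma same_point_refl : reflexive same_point.
Proof. by move=> p; apply/asboolP; exact: rst_refl. Qed.

Lemma same_point_sym : symmetric same_point.
Proof. by move=> p q; apply/asboolP/asboolP; exact: rst_sym. Qed.

Lemma same_point_trans : transitive same_point.
Proof.
move=> q p r /asboolP pq /asboolP qr; apply/asboolP.
exact: rst_trans pq qr.
Qed.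

Canonical same_point_equiv :=
  EquivRel same_point same_point_refl same_point_sym same_point_trans.

Definition chamanara : topologicalType :=
  quotient_topology {eq_quot same_point_equiv}%qT.

Definition midpoint : R * R := (2^-1, 2^-1).

Lemma midpoint_in_polygon : midpoint \in polygon.
Proof.
apply/mem_set; left; split=> /=; rewrite invr_gt0 ltr0n/=;
  by rewrite invf_lt1 ?ltr0n// ltr1n.
Qed.

(* Outside the polygon the value is the junk value [base_point]. *)
Definition surface_point (p : R * R) : chamanara :=
  (\pi_(chamanara) (insubd (exist _ midpoint midpoint_in_polygon : polygon) p))%qT.

Definition base_point : chamanara := surface_point midpoint.

(* Leaves the square at [p] and re-enters it at [q]; a closed curve when [p] and
   [q] are glued. *)
Definition crossing (p q : R * R) (t : R) : chamanara :=
  if t <= 2^-1 then surface_point (midpoint + (2 * t) *: (p - midpoint))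
  else surface_point (q + (2 * t - 1) *: (midpoint - q)).

(* 3 * 2^-(n+1) is the middle of ]2^-n, 2^(1-n)[, and 1 - 3 * 2^-(n+1) that of
   ]1 - 2^(1-n), 1 - 2^-n[. *)
Definition alpha n : R -> chamanara :=
  crossing (1, 3 * 2 ^- n.+1) (0, 1 - 3 * 2 ^- n.+1).
Definition beta n : R -> chamanara :=
  crossing (1 - 3 * 2 ^- n.+1, 0) (3 * 2 ^- n.+1, 1).

End Chamanara.

(* Loops are total functions on R of which only the restriction to [0, 1]
   matters. *)

Section FundamentalGroup.
Variables (R : realType) (T : topologicalType).
Implicit Types (x : T) (f g : R -> T).

Definition is_loop x f : Prop :=
  [/\ {within `[0, 1], continuous f}, f 0 = x & f 1 = x].

Definition loop_homotopic x f g : Prop :=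
  exists H : R * R -> T,
    [/\ {within `[0, 1] `*` `[0, 1], continuous H},
        {in `[0, 1], forall t, H (0, t) = f t},
        {in `[0, 1], forall t, H (1, t) = g t} &
        {in `[0, 1], forall s, H (s, 0) = x /\ H (s, 1) = x}].

Definition loop_concat f g (t : R) : T :=
  if t <= 2^-1 then f (2 * t) else g (2 * t - 1).

(* A homomorphism from the fundamental group of T at x to an abelian group,
   given as a function of loops that factors through homotopy classes. *)
Definition pi1_morphism (G : zmodType) x (kappa : (R -> T) -> G) : Prop :=
  (forall f g, is_loop x f -> is_loop x g -> loop_homotopic x f g ->
     kappa f = kappa g) /\
  (forall f g, is_loop x f -> is_loop x g ->
     kappa (loop_concat f g) = kappa f + kappa g).

End FundamentalGroup.

Section Coverings.
Variables (Y X : topologicalType).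

Definition homeo_onto (p : Y -> X) (V : set Y) (U : set X) : Prop :=
  exists s : X -> Y,
    [/\ set_fun V U p, set_fun U V s, {within U, continuous s},
        (forall y, V y -> s (p y) = y) & (forall x, U x -> p (s x) = x)].

Definition evenly_covered (p : Y -> X) (U : set X) : Prop :=
  exists sheets : set (set Y),
    [/\ p @^-1` U = \bigcup_(V in sheets) V,
        trivIset sheets id,
        (forall V, sheets V -> open V) &
        (forall V, sheets V -> homeo_onto p V U)].

Definition is_covering (p : Y -> X) : Prop :=
  [/\ continuous p, set_surj setT setT p &
      forall x, exists U, [/\ open U, U x & evenly_covered p U]].

Definition is_connected_covering (p : Y -> X) : Prop :=
  connected [set: Y] /\ is_covering p.

Definition deck (p : Y -> X) : set (Y -> Y) :=
  [set f | [/\ continuous f,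
               exists g : Y -> Y, [/\ continuous g, cancel f g & cancel g f] &
               forall y, p (f y) = p y]].

Definition is_normal_covering (p : Y -> X) : Prop :=
  is_connected_covering p /\
  forall y z, p y = p z -> exists2 f, deck p f & f y = z.

Definition is_finite_abelian_cover (p : Y -> X) : Prop :=
  [/\ is_normal_covering p, finite_set (deck p) &
      forall f g, deck p f -> deck p g -> f \o g = g \o f].

(* p_* pi_1(Y, y) = ker kappa, for some y over x, expressed on representing
   loops. *)
Definition corresponds_to_kernel (R : realType) (G : zmodType)
    (p : Y -> X) (x : X) (kappa : (R -> X) -> G) : Prop :=
  exists2 y, p y = x &
    forall f : R -> X, is_loop x f ->
      (kappa f = 0 <->
       exists2 g : R -> Y, is_loop y g & loop_homotopic x (p \o g) f).

End Coverings.

(* A (Freudenthal) end chooses, compatibly with inclusions, a connected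
   component of the complement of each compact set. *)
Definition ends (Y : topologicalType) :
    set ({K : set Y | compact K} -> set Y) :=
  [set e | (forall K, exists2 y, (~` sval K) y &
              e K = connected_component (~` sval K) y) /\
           (forall K L, sval K `<=` sval L -> e L `<=` e K)].

Definition has_n_ends (d : nat) (Y : topologicalType) : Prop :=
  (@ends Y #= `I_d)%card.

(* [<<_>>] is the generated subgroup for the additive structure of [G]. *)
Definition defining_vector (G : finZmodType) (h : int -> G) : Prop :=
  <<[set g : G | `[< exists i, h i = g >]]%SET>>%g = [set: G]%SET /\ h 0 = 0.

Section Kappa.
Variables (R : realType) (G : finZmodType) (h : int -> G).

Definition is_kappa (kappa : (R -> chamanara R) -> G) : Prop :=
  pi1_morphism (base_point R) kappa /\
  forall i, (1 <= i)%N ->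
    kappa (@alpha R i) = h i%:Z /\ kappa (@beta R i) = h (- i%:Z).

Definition is_cover_of_vector (Y : topologicalType) (p : Y -> chamanara R) :
    Prop :=
  is_normal_covering p /\
  exists2 kappa, is_kappa kappa & corresponds_to_kernel p (base_point R) kappa.

End Kappa.

(* Main.v *)
Require Import Defs.
From Stdlib Require Import Relations.
From HB Require Import structures.
From mathcomp Require Import all_boot all_order all_fingroup all_algebra.
From mathcomp Require Import all_classical all_reals all_analysis.
From mathcomp Require Import ring lra zify.

Set Implicit Arguments.
Unset Strict Implicit.
Unset Printing Implicit Defensive.

Import Order.TTheory GRing.Theory Num.Theory.
Import numFieldNormedType.Exports.

Local Open Scope classical_set_scope.
Local Open Scope ring_scope.

(** The number of ends never exceeds the number of sheets: a chain can be followed upwards until its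
    index is large and of the right parity, so every component outside a large compact set contains
    a point near the corner (0,1) of some sheet. Hence there are |G| ends iff these |G| points lie
    in distinct components from some level on, and the whole argument compares components, without
    loops near infinity. The vertical and the horizontal chains meet at index 0, where the missing
    points are the corners (0,0) and (1,1), each shared by a vertical and a horizontal side. This is
    why one alternating sum mixes positive and negative indices. A cover is given only through
    [kappa] on loops, so it is first turned into a [labelled_atlas]. Ends are counted from such an
    atlas alone, which serves both an arbitrary [Y] with defining vector [h] and the explicit model
    behind the existence claim. *)

(* The group that matters is generated by the labels of the loops near infinity.
   Outside a large compact set, X consists of neighbourhoods of the two corners
   (0,1) and (1,0) and of small half-discs around the endpoints of the segments.
   Every far segment leads from one corner to the other, and the half-discs form
   chains  L_n, R_(n-1), L_(n-2), ..., B_m  in which consecutive half-discs are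
   glued along a segment and which end near the corners again.  Hence all loops
   near infinity lift to loops, i.e. the cover has as many ends as sheets, iff the
   far segments have the same label and the alternating sum of the labels along
   the chains vanishes.

   A cover with deck group G is recovered from labelled copies of the polygon:
   the polygon is star-shaped, so it lifts to every sheet, and the lifts are glued
   along the n-th segments according to the values of kappa on alpha_n and
   beta_n. *)

(** * Covering maps *)

Section UnitInterval.
Variable R : realType.
Implicit Types s t : R.

(** Precomposition with this retraction makes a path that is continuous on [0, 1] continuous on the
    whole line, where connectedness and unique lifting apply. *)
Definition clamp t : R := Num.max 0 (Num.min t 1).

Lemma clamp_continuous : continuous clamp.
Proof.
move=> t; apply: (@continuous_max R R (cst 0) (fun s => Num.min s 1)).
  exact: cvg_cst.
by apply: (@continuous_min R R id (cst 1)); [exact: cvg_id|exact: cvg_cst].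
Qed.

Lemma clamp01 t : 0 <= clamp t <= 1.
Proof. by rewrite /clamp le_max lexx ge_max ler01 ge_min lexx orbT. Qed.

Lemma clamp_id t : 0 <= t <= 1 -> clamp t = t.
Proof. by move=> /andP[t0 t1]; rewrite /clamp min_l // max_r. Qed.

Lemma clamp_itv t : clamp t \in `[0, 1].
Proof. by rewrite in_itv /= clamp01. Qed.

Lemma real_line_connected : connected [set: R].
Proof. by apply/connected_intervalP. Qed.

Lemma nbhs_line (t : R) (A : set R) : nbhs t A ->
  exists2 e, 0 < e & forall s, `|s - t| < e -> A s.
Proof.
move/nbhs_ballP => [e /= e0 eA]; exists e => // s st; apply: eA.
by rewrite /ball /= distrC.
Qed.

Lemma within_clamp (T : topologicalType) (f : R -> T) :
  {within `[0, 1], continuous f} -> continuous (f \o clamp).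
Proof.
move/subspace_continuousP => cf t.
have ct : clamp s @[s --> t] --> within `[0, 1]%classic (nbhs (clamp t)).
  move=> W /= Wt.
  have := @clamp_continuous t [set r | r \in `[0, 1] -> W r] Wt.
  by apply: (@filterS _ (nbhs t)) => s /=; apply; exact: clamp_itv.
exact: cvg_comp ct (cf (clamp t) (clamp_itv t)).
Qed.

(** Near each [t] the truth of [P] does not vary, so [P] composed with [clamp] cuts out a set that
    is open and closed in the line. *)
Lemma unit_interval_induction (P : R -> Prop) : P 0 ->
  (forall t, 0 <= t <= 1 -> exists2 e, 0 < e & forall s s',
     0 <= s <= 1 -> 0 <= s' <= 1 -> `|s - t| < e -> `|s' - t| < e ->
     P s -> P s') ->
  forall t, 0 <= t <= 1 -> P t.
Proof.
move=> P0 Pstep.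
have near_clamp t : \forall s \near t, P (clamp s) <-> P (clamp t).
  have [e e0 Pe] := Pstep _ (clamp01 t).
  have /cvgrPdist_lt /(_ e e0) := @clamp_continuous t.
  apply: filterS => s; rewrite distrC => ste.
  have tte : `|clamp t - clamp t| < e by rewrite subrr normr0.
  by split; apply: Pe => //; exact: clamp01.
pose A := [set t | P (clamp t)].
suff AT : A = setT.
  by move=> t t01; rewrite -(clamp_id t01); have : A t by rewrite AT.
apply: real_line_connected.
- by exists 0; rewrite /A /= clamp_id ?lexx ?ler01.
- exists A; rewrite ?setTI// openE => t At.
  by apply: filterS (near_clamp t) => s [_]; exact.
- exists A; rewrite ?setTI// -openC openE => t At.
  by apply: filterS (near_clamp t) => s [+ _] As; move/(_ As).
Qed.

End UnitInterval.

Lemma continuous_pair (Z A B : topologicalType) (f : Z -> A) (g : Z -> B) z :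
  {for z, continuous f} -> {for z, continuous g} ->
  {for z, continuous (fun x => (f x, g x))}.
Proof.
move=> cf cg W [[M N] /= [fM gN] MNW].
have cfM := cf _ fM; have cgN := cg _ gN.
apply: (@filterS _ (nbhs z) _ (f @^-1` M `&` g @^-1` N)); last exact: filterI.
by move=> x [Mx Nx]; exact: MNW.
Qed.

Lemma segment_between (R : realDomainType) (a b s r q : R) : 0 <= q <= 1 ->
  a < s < b -> a < r < b -> a < s + q * (r - s) < b.
Proof.
move=> /andP[q0 q1] /andP[as_ sb] /andP[ar rb].
have -> : s + q * (r - s) = (1 - q) * s + q * r by ring.
(* The larger of the two weights is positive, which makes the inequality strict. *)
by apply/andP; split; have [q12|q12] := leP q (1 - q); nra.
Qed.

Lemma segment_between_le (R : realDomainType) (a b s r q : R) : 0 <= q <= 1 ->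
  a <= s <= b -> a <= r <= b -> a <= s + q * (r - s) <= b.
Proof. by move=> /andP[q0 q1] /andP[? ?] /andP[? ?]; apply/andP; split; nra. Qed.

Section Covering.
Variables (R : realType) (Y X : topologicalType) (p : Y -> X).
Hypothesis covp : is_covering p.

Lemma covering_chart (x : X) : exists U : set X, [/\ open U, U x &
  forall y, U (p y) -> exists (V : set Y) (s : X -> Y),
    [/\ open V /\ V y, (forall v, V v -> U (p v)),
        (forall u, U u -> {for u, continuous s}),
        (forall v, V v -> s (p v) = v) &
        (forall u, U u -> V (s u) /\ p (s u) = u)]].
Proof.
have [_ _ /(_ x) [U [oU Ux [F [FU _ oF hF]]]]] := covp.
exists U; split=> // y Uy.
have : (p @^-1` U) y by [].
rewrite FU => -[V FV Vy]; exists V.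
have [s [pV sV cs sp ps]] := hF _ FV; exists s; split=> //.
- by split=> //; exact: oF.
- by move: cs; rewrite continuous_open_subspace// => cs u Uu; apply: cs; rewrite inE.
- by move=> u Uu; split; [exact: sV|exact: ps].
Qed.

Lemma covering_local_injective y : exists V : set Y,
  [/\ open V, V y & forall v w, V v -> V w -> p v = p w -> v = w].
Proof.
have [U [oU Uy /(_ y Uy) [V [s [[oV Vy] _ _ sp _]]]]] := covering_chart (p y).
by exists V; split=> // v w Vv Vw vw; rewrite -(sp _ Vv) -(sp _ Vw) vw.
Qed.

(** Takes the place of a Hausdorff assumption: distinct points of a fibre lie in distinct sheets
    over one evenly covered set. *)
Lemma covering_separated y y' : p y = p y' -> y <> y' ->
  exists V V' : set Y, [/\ open V /\ V y, open V' /\ V' y' &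
    forall v, V v -> V' v -> False].
Proof.
move=> yy' neq; have [_ _ /(_ (p y)) [U [oU Uy [F [FU tF oF hF]]]]] := covp.
have : (p @^-1` U) y by [].
rewrite FU => -[V FV Vy].
have : (p @^-1` U) y' by rewrite /= -yy'.
rewrite FU => -[V' FV' Vy'].
exists V, V'; split; [by split=> //; exact: oF..|].
move=> v Vv V'v.
have VV' : V = V' by apply: tF => //; exists v.
have [s [_ _ _ sp _]] := hF _ FV.
by apply: neq; rewrite -(sp y) // -(sp y') ?yy' // VV'.
Qed.

(** The set where the lifts agree is open by local injectivity of [p] and closed by
    [covering_separated]. *)
Lemma unique_lifting (Z : topologicalType) (f g : Z -> Y) (z0 : Z) :
  connected [set: Z] -> continuous f -> continuous g ->
  (forall z, p (f z) = p (g z)) -> f z0 = g z0 -> f =1 g.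
Proof.
move=> cZ cf cg fg fg0; pose A := [set z | f z = g z].
suff AT : A = setT by move=> z; have : A z by rewrite AT.
have nbf z V : open V -> V (f z) -> nbhs z (f @^-1` V).
  by move=> oV Vz; apply: cf; exact: open_nbhs_nbhs.
have nbg z V : open V -> V (g z) -> nbhs z (g @^-1` V).
  by move=> oV Vz; apply: cg; exact: open_nbhs_nbhs.
apply: cZ; first by exists z0.
- exists A; rewrite ?setTI// openE => z Az.
  have [V [oV Vz Vinj]] := covering_local_injective (f z).
  have Vgz : V (g z) by rewrite -Az.
  apply: filterS (filterI (nbf _ _ oV Vz) (nbg _ _ oV Vgz)) => w [] /= Vf Vg.
  exact: Vinj.
- exists A; rewrite ?setTI// -openC openE => z Az.
  have [V [V' [[oV Vz] [oV' Vz'] VV']]] := covering_separated (fg z) Az.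
  apply: filterS (filterI (nbf _ _ oV Vz) (nbg _ _ oV' Vz')) => w [] /= Vf Vg.
  by rewrite /A /= => e; apply: (VV' (f w)) => //; rewrite e.
Qed.

(** Induction on the length of the interval already lifted: a lift is either restricted, or
    prolonged by the local inverse of [p] on the sheet through its current end. *)
Lemma path_lifting (c : R -> X) (y : Y) : continuous c -> p y = c 0 ->
  exists f : R -> Y, [/\ continuous f, f 0 = y &
    forall t, 0 <= t <= 1 -> p (f t) = c t].
Proof.
move=> cc yc.
pose lift t (f : R -> Y) := [/\ {within `[0, t], continuous f}, f 0 = y &
  forall s, 0 <= s <= t -> p (f s) = c s].
suff [f [cf f0 pf]] : exists f, lift 1 f.
  exists (f \o clamp (R := R)); split.
  - exact: within_clamp.
  - by rewrite /= clamp_id ?lexx ?ler01.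
  - by move=> t t01 /=; rewrite clamp_id // pf.
apply: (@unit_interval_induction R (fun t => exists f, lift t f)); last first.
- by rewrite ler01 lexx.
- move=> t t01.
  have [U [oU Ut chart]] := covering_chart (c t).
  have /nbhs_line [e e0 eU] : nbhs t (c @^-1` U).
    by apply: cc; exact: open_nbhs_nbhs.
  exists e => // s s' s01 s'01 st s't [f [cf f0 pf]].
  have [s's|ss'] := leP s' s.
    exists f; split=> //.
      apply: continuous_subspaceW cf => r /=; rewrite !in_itv /= => /andP[-> rs'] /=.
      exact: le_trans s's.
    by move=> r /andP[r0 rs]; apply: pf; rewrite r0 (le_trans rs).
  have [r0 r1] := andP s01.
  have pfs : p (f s) = c s by apply: pf; rewrite lexx r0.
  have Ufs : U (p (f s)) by rewrite pfs; exact: eU.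
  have [V [g [[oV Vs] VU cg gp Vg]]] := chart _ Ufs.
  have Uc r : s <= r <= s' -> U (c r).
    move=> /andP[sr rs']; apply: eU; move: st s't.
    by rewrite !ltr_distl => /andP[? ?] /andP[? ?]; lra.
  exists (fun r => if r <= s then f r else g (c r)); split; last 2 first.
  + by rewrite r0.
  + move=> r /andP[r_ge0 rs']; case: leP => rs; first by apply: pf; rewrite r_ge0.
    by apply: (Vg _ _).2; apply: Uc; rewrite (ltW rs).
  have -> : `[0, s']%classic = `[0, s]%classic `|` `[s, s']%classic.
    apply/seteqP; split=> r /=; rewrite !in_itv /=.
      by move=> /andP[? ?]; case: (leP r s) => ?; [left|right]; lra.
    by case=> /andP[? ?]; lra.
  apply: withinU_continuous.
  + exact: interval_closed.
  + exact: interval_closed.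
  + apply: subspace_eq_continuous cf => r; rewrite inE /= in_itv /=.
    by rewrite /from_subspace => /andP[_ ->].
  + apply: (@subspace_eq_continuous _ _ _ (g \o c)).
      move=> r; rewrite inE /= in_itv /= => /andP[sr rs'].
      rewrite /from_subspace /=; case: leP => // rs; have -> : r = s by lra.
      by rewrite -pfs gp.
    apply: continuous_in_subspaceT => r; rewrite inE /= in_itv /= => rss.
    apply: continuous_comp; first exact: cc.
    by apply: cg; exact: Uc.
- exists (cst y); split=> //; first by move=> t; exact: cvg_cst.
  by move=> s s0; have -> : s = 0 by lra.
Qed.


(* The lifts of the paths t |-> H(z, t) are jointly continuous: the set of the
   times t at which they depend continuously on z near z0 is both open and
   closed. *)
Lemma homotopy_lifting (Z : topologicalType) (H : Z * R -> X) (f : Z -> Y) :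
  continuous H -> continuous f -> (forall z, p (f z) = H (z, 0)) ->
  exists K : Z * R -> Y, [/\ continuous K, (forall z, K (z, 0) = f z) &
    forall z t, 0 <= t <= 1 -> p (K (z, t)) = H (z, t)].
Proof.
move=> cH cf pf.
have cHz z : continuous (fun t => H (z, t)).
  by move=> t; apply: (@continuous_comp _ _ _ (fun t => (z, t)) H);
    [apply: continuous_pair; [exact: cvg_cst|exact: cvg_id]|exact: cH].
have [L Lz] := choice (fun z => path_lifting (cHz z) (pf z)).
have cL z : continuous (L z) by have [] := Lz z.
have L0 z : L z 0 = f z by have [] := Lz z.
have pL z t : 0 <= t <= 1 -> p (L z t) = H (z, t).
  by have [_ _] := Lz z; apply.
pose P z0 t := {for z0, continuous (fun z => L z t)}.
(* Continuity in [z] at one time [s] close to [t] puts all [L z s] with [z] near [z0] in one sheet;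
   at the other times close to [t] the lifts are then given by the same local inverse [g]. *)
have local z0 t : 0 <= t <= 1 -> exists2 e, 0 < e & forall s,
    0 <= s <= 1 -> `|s - t| < e -> P z0 s ->
    exists (N : set Z) (g : X -> Y), nbhs z0 N /\
      forall z r, N z -> 0 <= r <= 1 -> `|r - t| < e ->
        L z r = g (H (z, r)) /\ {for H (z, r), continuous g}.
  move=> t01; have [U [oU Ut chart]] := covering_chart (H (z0, t)).
  have /cH : nbhs (H (z0, t)) U by exact: open_nbhs_nbhs.
  case=> -[N I] /= [Nz It] NIU.
  have [e e0 eI] := nbhs_line It; exists e => // s s01 ste Ps.
  have UH z r : N z -> `|r - t| < e -> U (H (z, r)).
    by move=> Nz' rte; apply: (NIU (z, r)); split => //=; exact: eI.
  have Us : U (p (L z0 s)) by rewrite pL//; apply: UH => //; exact: nbhs_singleton.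
  have [V [g [[oV Vs] VU cg gp Vg]]] := chart _ Us.
  have /Ps NV : nbhs (L z0 s) V by exact: open_nbhs_nbhs.
  exists (N `&` (fun z => V (L z s))), g; split; first exact: filterI.
  move=> z r [Nz' Vz] r01 rte; split; last by apply: cg; exact: UH.
  (* A path of times from [s] to [r] that stays close to [t]; along it [L z] and [g] after [H] are
     two lifts that agree at the start. *)
  pose c (q : R) := s + clamp q * (r - s).
  have [s0 s1] := andP s01; have [r0 r1] := andP r01.
  have cc : continuous c.
    move=> q; apply: cvgD; first exact: cvg_cst.
    by apply: cvgM; [exact: clamp_continuous|exact: cvg_cst].
  have c01 q : 0 <= c q <= 1 /\ `|c q - t| < e.
    move: ste rte; rewrite /c !ltr_distl => ste rte.
    by split; [apply: segment_between_le|apply: segment_between]; rewrite ?clamp01.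
  have -> : r = c 1 by rewrite /c clamp_id ?ler01 ?lexx//; lra.
  apply: (@unique_lifting _ (L z \o c) (fun q => g (H (z, c q))) 0).
  - exact: real_line_connected.
  - by move=> q; apply: continuous_comp; [exact: cc|exact: cL].
  - move=> q; apply: (@continuous_comp _ _ _ (fun q => H (z, c q)) g).
      apply: (@continuous_comp _ _ _ c (fun t => H (z, t))); first exact: cc.
      exact: cHz.
    by apply: cg; apply: UH => //; exact: (c01 q).2.
  - move=> q /=; have [cq01 cqe] := c01 q.
    by rewrite pL// (Vg _ _).2//; exact: UH.
  - rewrite /= /c clamp_id ?ler01 ?lexx// mul0r addr0.
    by rewrite -pL// gp.
have LP z0 t : 0 <= t <= 1 -> P z0 t.
  move: t; apply: unit_interval_induction.
    rewrite /P (_ : (fun z => L z 0) = f); last exact/funext.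
    exact: cf.
  move=> t t01; have [e e0 He] := local z0 t t01; exists e => // s s' s01 s'01 st s't.
  move=> /(He s s01 st)[N [g [Nz Ng]]].
  have [Lg cg] := Ng z0 s' (nbhs_singleton Nz) s'01 s't.
  rewrite /P /prop_for /continuous_at Lg.
  apply: (@cvg_trans _ (g (H (z, s')) @[z --> z0])).
    apply: near_eq_cvg; apply: filterS Nz => z Nz'.
    by have [-> _] := Ng z s' Nz' s'01 s't.
  apply: (@continuous_comp _ _ _ (fun z => H (z, s')) g) => //.
  apply: (@continuous_comp _ _ _ (fun z => (z, s')) H); last exact: cH.
  by apply: continuous_pair; [exact: cvg_id|exact: cvg_cst].
exists (fun zt => L zt.1 (clamp zt.2)); split; last 2 first.
- by move=> z; rewrite /= clamp_id ?ler01 ?lexx.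
- by move=> z t t01; rewrite /= clamp_id// pL.
move=> [z0 t0].
have [e e0 He] := local z0 _ (clamp01 t0).
have tte : `|clamp t0 - clamp t0| < e by rewrite subrr normr0.
have [N [g [Nz Ng]]] := He _ (clamp01 t0) tte (LP z0 _ (clamp01 t0)).
have [Lg cg] := Ng z0 _ (nbhs_singleton Nz) (clamp01 t0) tte.
rewrite /continuous_at /= Lg.
have cgH : {for (z0, t0), continuous (fun zt => g (H (zt.1, clamp zt.2)))}.
  apply: (@continuous_comp _ _ _ (fun zt => H (zt.1, clamp zt.2)) g) => //=.
  apply: (@continuous_comp _ _ _ (fun zt => (zt.1, clamp zt.2)) H); last exact: cH.
  apply: continuous_pair; first exact: cvg_fst.
  apply: (@continuous_comp _ _ _ snd (@clamp R)); first exact: cvg_snd.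
  exact: clamp_continuous.
apply: cvg_trans cgH; apply: near_eq_cvg.
exists (N, [set t | `|clamp t - clamp t0| < e]).
  split=> //=; have /cvgrPdist_lt /(_ e e0) := @clamp_continuous R t0.
  by apply: filterS => t; rewrite distrC.
by case=> z t /= [Nz' te]; have [-> _] := Ng z _ Nz' (clamp01 t) te.
Qed.

End Covering.

(** * The polygon *)

Section Polygon.
Variable R : realType.
Implicit Types (p q : R * R) (s e : bool) (n m : nat) (t eps : R).

Notation half n := (2 ^- n : R).

Lemma half_gt0 n : 0 < half n.
Proof. by rewrite invr_gt0 exprn_gt0. Qed.

Lemma halfS n : half n = 2 * half n.+1.
Proof. by rewrite exprS invfM mulrA divff ?mul1r. Qed.

Lemma half_le1 n : half n <= 1.
Proof. by rewrite invf_le1 ?exprn_gt0// exprn_ege1// ler1n. Qed.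

Lemma half_le n m : (n <= m)%N -> half m <= half n.
Proof. by move=> nm; rewrite lef_pV2 ?posrE ?exprn_gt0// ler_eXn2l// ltr1n. Qed.

Lemma half_lt n m : half m < half n -> (n < m)%N.
Proof. by rewrite ltnNge; apply: contraTN => /half_le; rewrite -leNgt. Qed.

Lemma half_small t : 0 < t -> exists n, half n < t.
Proof.
move=> t0; exists (Num.truncn t^-1).+1.
rewrite -[ltRHS]invrK ltf_pV2 ?posrE ?invr_gt0 ?exprn_gt0//.
apply: lt_trans (truncnS_gt _) _.
by rewrite -natrX ltr_nat ltn_expl.
Qed.

(* Vertical sides are indexed by [false] and horizontal ones by [true]; the
   left and bottom sides are the low ends [false], the right and top sides the
   high ends [true]. *)
Definition coord s (a t : R) : R * R := if s then (t, a) else (a, t).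

Definition side_pos e : R := if e then 1 else 0.

(* Parametrises the segment that the paper indexes by [n.+1]. *)
Definition side_point s e n t : R * R :=
  coord s (side_pos e) (if e then half n.+1 + t else 1 - half n + t).

(** The endpoints missing from the polygon: indices [n] and [n.+1] bound the segment [n]. Index 0
    gives (0,0) on a low side and (1,1) on a high side, whatever [s] is. *)
Definition bad_point s e n : R * R :=
  coord s (side_pos e) (if e then half n else 1 - half n).

Definition side_range n t := 0 < t < half n.+1.

Lemma polygonP p : @polygon R p <-> @open_square R p \/
  exists s e n t, side_range n t /\ p = side_point s e n t.
Proof.
split.
- case: p => u v [|[[//|n] _]]; first by left.
  have hn := halfS n.
  move=> H; right; case: H => -[[]|[]] /= -> /andP[? ?].
  + exists false, false, n, (v - (1 - half n)).
    split; first by apply/andP; split; lra.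
    by rewrite /side_point /coord /=; congr pair; ring.
  + exists false, true, n, (v - half n.+1).
    split; first by apply/andP; split; lra.
    by rewrite /side_point /coord /=; congr pair; ring.
  + exists true, false, n, (u - (1 - half n)).
    split; first by apply/andP; split; lra.
    by rewrite /side_point /coord /=; congr pair; ring.
  + exists true, true, n, (u - half n.+1).
    split; first by apply/andP; split; lra.
    by rewrite /side_point /coord /=; congr pair; ring.
- case=> [|[s [e [n [t [/andP[t0 tn] ->]]]]]]; first by left.
  right; exists n.+1 => //.
  have hn := halfS n.
  by case: s; case: e; [right; right|right; left|left; right|left; left];
    (split=> //=; apply/andP; split; lra).
Qed.

Lemma gluedP p q : glued p q <-> exists s n t,
  [/\ side_range n t, p = side_point s false n t & q = side_point s true n t].
Proof.
split.
- case: p => u v [[//|n] _]; have hn := halfS n.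
  case=> -[[/= -> /andP[? ?]] _ ->].
  + exists false, n, (v - (1 - half n)).
    by split; [apply/andP; split; lra|congr pair => /=; ring..].
  + exists true, n, (u - (1 - half n)).
    by split; [apply/andP; split; lra|congr pair => /=; ring..].
- move=> [s [n [t [/andP[t0 tn] -> ->]]]]; exists n.+1 => //.
  have hn := halfS n.
  case: s; [right|left]; split.
  + by split=> //=; apply/andP; split; lra.
  + by split=> //=; apply/andP; split; lra.
  + by congr pair => /=; ring.
  + by split=> //=; apply/andP; split; lra.
  + by split=> //=; apply/andP; split; lra.
  + by congr pair => /=; ring.
Qed.

Lemma side_point_polygon s e n t : side_range n t -> @polygon R (side_point s e n t).
Proof. by move=> nt; apply/polygonP; right; exists s, e, n, t. Qed.

Lemma side_point_not_open s e n t : ~ @open_square R (side_point s e n t).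
Proof. by case: s; case: e => -[/= /andP[? ?] /andP[? ?]]; lra. Qed.

Lemma side_point_inj s e n t s' e' n' t' :
  side_range n t -> side_range n' t' ->
  side_point s e n t = side_point s' e' n' t' ->
  [/\ s = s', e = e', n = n' & t = t'].
Proof.
move=> /andP[t0 tn] /andP[t'0 tn'].
have [hn hn'] := (halfS n, halfS n').
have [ln ln'] := (half_le1 n, half_le1 n').
have [pn pn'] := (half_gt0 n.+1, half_gt0 n'.+1).
(* Two open dyadic intervals that meet have the same index. *)
have index : half n'.+1 < half n -> half n.+1 < half n' -> n = n'.
  by move=> /half_lt nn' /half_lt; lia.
move=> h; move: (congr1 fst h) (congr1 snd h).
rewrite /side_point /coord {h}; case: s; case: s'; case: e; case: e' => /= h1 h2;
  try lra.
all: have nn' : n = n' by apply: index; lra.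
all: by subst n'; split=> //; lra.
Qed.

Let midpoint_polygon : @polygon R := exist _ (midpoint R) (midpoint_in_polygon R).

(* Outside the polygon the value is the junk value [midpoint R]. *)
Definition to_polygon p : @polygon R := insubd midpoint_polygon p.

Lemma to_polygonK p : @polygon R p -> set_val (to_polygon p) = p.
Proof. by move=> pP; exact: (insubdK _ (mem_set pP)). Qed.

Lemma to_polygon_val (x : @polygon R) : to_polygon (set_val x) = x.
Proof. exact: valKd. Qed.

Lemma polygon_val (x : @polygon R) : @polygon R (set_val x).
Proof. exact: set_valP. Qed.

Lemma surface_pointE p : surface_point p = (\pi_(chamanara R) (to_polygon p))%qT.
Proof. by []. Qed.

(** No point is both low and high, and each side point has a single partner, so chains of gluings
    collapse to at most one step. *)
Lemma same_pointP (x y : @polygon R) : same_point x y <->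
  [\/ x = y, glued (set_val x) (set_val y) | glued (set_val y) (set_val x)].
Proof.
split; last first.
  move=> H; apply/asboolP; case: H => [->|xy|yx]; first exact: rst_refl.
    exact: rst_step.
  exact/rst_sym/rst_step.
move/asboolP; elim.
- by move=> {}x {}y xy; apply: Or32.
- by move=> {}x; apply: Or31.
- by move=> {}x {}y _ [->|xy|yx]; [apply: Or31|apply: Or33|apply: Or32].
- move=> {}x {}y z _ xy _ yz; case: xy => [->//||]; case: yz => [<-||].
  + by apply: Or32.
  + move=> /gluedP[s [n [t [nt xs ys]]]] /gluedP[s' [n' [t' [nt' xs' ys']]]].
    by have [] := side_point_inj nt nt' (etrans (esym xs) ys').
  + move=> /gluedP[s [n [t [nt xs ys]]]] /gluedP[s' [n' [t' [nt' xs' ys']]]].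
    have [es _ en et] := side_point_inj nt nt' (etrans (esym ys) ys').
    by apply: Or31; rewrite -[x]to_polygon_val -[z]to_polygon_val xs xs' es en et.
  + by apply: Or33.
  + move=> /gluedP[s [n [t [nt xs ys]]]] /gluedP[s' [n' [t' [nt' xs' ys']]]].
    have [es _ en et] := side_point_inj nt nt' (etrans (esym xs) xs').
    by apply: Or31; rewrite -[x]to_polygon_val -[z]to_polygon_val ys ys' es en et.
  + move=> /gluedP[s [n [t [nt xs ys]]]] /gluedP[s' [n' [t' [nt' xs' ys']]]].
    by have [] := side_point_inj nt nt' (etrans (esym ys) xs').
Qed.

Definition surface (x : @polygon R) : chamanara R := (\pi_(chamanara R) x)%qT.

Lemma surface_continuous : continuous surface.
Proof. exact: pi_continuous. Qed.

Lemma surface_onto (y : chamanara R) : exists x, surface x = y.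
Proof. by exists (generic_quotient.repr y); exact: generic_quotient.reprK. Qed.

Lemma surface_open (U : set (chamanara R)) : open (surface @^-1` U) -> open U.
Proof. by []. Qed.

Lemma surfaceP (x y : @polygon R) : surface x = surface y <->
  [\/ x = y, glued (set_val x) (set_val y) | glued (set_val y) (set_val x)].
Proof.
rewrite -same_pointP.
by split; [move=> /eqmodP|move=> xy; apply/eqmodP].
Qed.

Lemma surface_side s n t : side_range n t ->
  surface (to_polygon (side_point s false n t)) =
  surface (to_polygon (side_point s true n t)).
Proof.
move=> nt; apply/surfaceP; apply: Or32; apply/gluedP; exists s, n, t.
by rewrite !to_polygonK//; exact: side_point_polygon.
Qed.

Lemma to_polygon_within (A : set (R * R)) : A `<=` @polygon R ->
  {within A, continuous to_polygon}.
Proof.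
move=> AP; apply/subspace_continuousP => x Ax U [_ /= [[W oW <-] /= Wx WU]].
rewrite to_polygonK in Wx; last exact: AP.
have Wn : nbhs x W by exact: open_nbhs_nbhs.
rewrite /within /=; apply: filterS Wn => z Wz Az.
by apply: WU; rewrite /= to_polygonK//; exact: AP.
Qed.

Lemma to_polygon_continuous (T : topologicalType) (f : T -> R * R) :
  continuous f -> (forall z, @polygon R (f z)) -> continuous (to_polygon \o f).
Proof.
move=> cf fP x U [_ /= [[W oW <-] /= Wx WU]].
rewrite to_polygonK// in Wx.
have := cf x W (open_nbhs_nbhs (conj oW Wx)).
apply: (@filterS _ (nbhs x)) => z Wz.
by apply: WU; rewrite /= to_polygonK.
Qed.

Lemma polygon_val_continuous : continuous (set_val : @polygon R -> R * R).
Proof. exact: initial_continuous. Qed.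

Lemma preimage_open (W : set (R * R)) : open W -> open (set_val @^-1` W : set (@polygon R)).
Proof. by move=> oW; move/continuousP: polygon_val_continuous; apply. Qed.

Lemma compact_preimage (A : set (R * R)) : A `<=` @polygon R -> compact A ->
  compact (set_val @^-1` A : set (@polygon R)).
Proof.
move=> AP cA; have -> : (set_val @^-1` A : set (@polygon R)) = to_polygon @` A.
  apply/seteqP; split=> [x Ax|_ [a Aa <-]] /=.
    by exists (set_val x) => //; rewrite to_polygon_val.
  by rewrite to_polygonK//; exact: AP.
by apply: continuous_compact => //; exact: to_polygon_within.
Qed.

Definition ray c x t : R * R := c + t *: (x - c).

Lemma rayE c x t :
  ray c x t = (c.1 + t * (x.1 - c.1), c.2 + t * (x.2 - c.2)).
Proof. by []. Qed.

Lemma ray0 c x : ray c x 0 = c.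
Proof. by rewrite /ray scale0r addr0. Qed.

Lemma ray1 c (x : R * R) : ray c x 1 = x.
Proof. by rewrite /ray scale1r addrC subrK. Qed.

Lemma ray_continuous c : continuous (fun xt : (R * R) * R => ray c xt.1 xt.2).
Proof.
move=> [x t]; rewrite /ray; apply: (@cvgD _ (R * R)%type); first exact: cvg_cst.
apply: (@cvgZ _ (R * R)%type); first exact: cvg_snd.
by apply: cvgB; [exact: cvg_fst|exact: cvg_cst].
Qed.

Lemma polygon_square p : @polygon R p -> 0 <= p.1 <= 1 /\ 0 <= p.2 <= 1.
Proof.
move=> /polygonP[[/andP[? ?] /andP[? ?]]|]; first by split; apply/andP; split; lra.
move=> [s [e [n [t [/andP[t0 tn] ->]]]]].
have [[hn ln] pn] := (halfS n, half_le1 n, half_gt0 n.+1).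
by case: s; case: e; split=> /=; apply/andP; split; lra.
Qed.

Lemma ray_open_square c x t : @open_square R c ->
  0 <= x.1 <= 1 -> 0 <= x.2 <= 1 -> 0 <= t < 1 -> @open_square R (ray c x t).
Proof.
move=> [/andP[? ?] /andP[? ?]] /andP[? ?] /andP[? ?] /andP[? ?].
by rewrite rayE; split=> /=; apply/andP; split; nra.
Qed.

Lemma ray_polygon c x t : @open_square R c -> @polygon R x -> 0 <= t <= 1 ->
  @polygon R (ray c x t).
Proof.
move=> oc px /andP[t0]; rewrite le_eqVlt => /orP[/eqP->|t1]; first by rewrite ray1.
have [x1 x2] := polygon_square px.
by left; apply: ray_open_square => //; rewrite t0.
Qed.

(** Being star-shaped around [c] suffices: the set is a union of rays from [c], and a ray to a point
    of the polygon stays in the open square before its end. *)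
Lemma convex_polygon_connected (C : set (R * R)) c : C c -> @open_square R c ->
  (forall x t, C x -> @polygon R x -> 0 <= t <= 1 -> C (ray c x t)) ->
  connected (set_val @^-1` C : set (@polygon R)).
Proof.
move=> Cc oc Cray.
pose D (x : @polygon R) : set (@polygon R) :=
  range (fun t : R => to_polygon (ray c (set_val x) (clamp t))).
have DP (x : @polygon R) t : set_val (to_polygon (ray c (set_val x) (clamp t))) =
    ray c (set_val x) (clamp t).
  by rewrite to_polygonK//; apply: ray_polygon => //; [exact: polygon_val|exact: clamp01].
have -> : (set_val @^-1` C : set (@polygon R)) =
    \bigcup_(x in set_val @^-1` C) D x.
  apply/seteqP; split=> [x Cx|_ [x Cx [t _ <-]]].
    by exists x => //; exists 1 => //; rewrite clamp_id ?ler01 ?lexx// ray1 to_polygon_val.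
  rewrite /= DP; apply: Cray => //; [exact: polygon_val|exact: clamp01].
apply: bigcup_connected.
  exists (to_polygon c) => x Cx; exists 0 => //.
  by rewrite clamp_id ?ler01 ?lexx// ray0.
move=> x Cx; apply: connected_continuous_connected; first exact: real_line_connected.
apply: continuous_subspaceT; apply: to_polygon_continuous.
  move=> t; apply: (@continuous_comp _ _ _ (fun t => (set_val x, clamp t)) (fun xt => ray c xt.1 xt.2)).
    by apply: continuous_pair; [exact: cvg_cst|exact: clamp_continuous].
  exact: ray_continuous.
by move=> t; apply: ray_polygon => //; [exact: polygon_val|exact: clamp01].
Qed.

(** * Neighbourhoods of the missing points: open squares, for which overlaps are linear
    inequalities *)

Definition near_pt eps (b p : R * R) : Prop :=
  `|p.1 - b.1| < eps /\ `|p.2 - b.2| < eps.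

Lemma near_pt_open eps b : open [set p | near_pt eps b p].
Proof.
have -> : [set p | near_pt eps b p] =
    fst @^-1` [set a | `|a - b.1| < eps] `&` snd @^-1` [set a | `|a - b.2| < eps].
  by [].
have lt_open (a : R) : open [set z : R | `|z - a| < eps].
  rewrite (_ : [set z : R | _] = (fun z => `|z - a|) @^-1` [set z | z < eps]) //.
  apply: open_comp; last exact: open_lt.
  by move=> z _; apply: cvg_norm; apply: cvgB; [exact: cvg_id|exact: cvg_cst].
by apply: openI; apply: open_comp => // z _; [exact: cvg_fst|exact: cvg_snd].
Qed.

Lemma ray_near eps b c p t : near_pt eps b c -> near_pt eps b p ->
  0 <= t <= 1 -> near_pt eps b (ray c p t).
Proof.
rewrite /near_pt !ltr_distl => -[c1 c2] [p1 p2] t01.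
by rewrite rayE; split=> /=; apply: segment_between.
Qed.

Lemma bad_square s e n : 0 <= (bad_point s e n).1 <= 1 /\ 0 <= (bad_point s e n).2 <= 1.
Proof.
have [ln pn] := (half_le1 n, half_gt0 n).
by case: s; case: e; split=> /=; apply/andP; split; lra.
Qed.

Definition cell eps b : set (@polygon R) := [set x | near_pt eps b (set_val x)].

Lemma cell_open eps b : open (cell eps b).
Proof.
by apply: (@preimage_open [set p | near_pt eps b p]); exact: near_pt_open.
Qed.

Lemma cell_connected eps s e n : 0 < eps <= 1 -> connected (cell eps (bad_point s e n)).
Proof.
move=> /andP[e0 e1]; set b := bad_point s e n.
have [/andP[? ?] /andP[? ?]] : 0 <= b.1 <= 1 /\ 0 <= b.2 <= 1 := bad_square s e n.
(* The star centre is [b] moved the fraction [eps] of the way to the midpoint: interior to the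
   square, and within [eps] of [b]. *)
apply: (@convex_polygon_connected [set p | near_pt eps b p]
  (b.1 + eps * (2^-1 - b.1), b.2 + eps * (2^-1 - b.2))).
- by split; rewrite /= ltr_distl; apply/andP; split; nra.
- by split; apply/andP; split => /=; nra.
- move=> p t bp _ t01; apply: ray_near => //.
  by split; rewrite /= ltr_distl; apply/andP; split; nra.
Qed.

(** As [t] grows, a low side leaves its bad point [n] while a high side approaches it. Gluing keeps
    [t], so it matches index [n] on one side with [n.+1] on the other; this is what makes the chains
    descend. *)
Lemma side_near s e n t eps b : side_range n t -> 0 < eps -> b = bad_point s e n ->
  near_pt eps b (side_point s e n t) <-> if e then half n.+1 - t < eps else t < eps.
Proof.
move=> /andP[t0 tn] e0 ->; have hn := halfS n.
case: s; case: e; rewrite /near_pt /= !ltr_distl;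
  split=> [[/andP[? ?] /andP[? ?]]|?]; try lra.
all: by split; apply/andP; split; lra.
Qed.

Lemma side_nearS s e n t eps b : side_range n t -> 0 < eps -> b = bad_point s e n.+1 ->
  near_pt eps b (side_point s e n t) <-> if e then t < eps else half n.+1 - t < eps.
Proof.
move=> /andP[t0 tn] e0 ->; have hn := halfS n.
case: s; case: e; rewrite /near_pt /= !ltr_distl;
  split=> [[/andP[? ?] /andP[? ?]]|?]; try lra.
all: by split; apply/andP; split; lra.
Qed.

(** No bad point is closer than the nearer end of the segment: those on the same side lie beyond an
    end, and those on other sides are at least as far away. *)
Lemma side_near_end s e n t eps s' e' n' : side_range n t ->
  near_pt eps (bad_point s' e' n') (side_point s e n t) ->
  near_pt eps (bad_point s e n) (side_point s e n t) \/
  near_pt eps (bad_point s e n.+1) (side_point s e n t).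
Proof.
move=> nt near'.
have e0 : 0 < eps by case: near' => h _; apply: le_lt_trans h.
rewrite (side_near nt e0 erefl) (side_nearS nt e0 erefl).
suff : t < eps \/ half n.+1 - t < eps by case: e {near'}; tauto.
have [te|te] := ltP t eps; [by left|right].
have hab : half n <= half n' \/ half n' <= half n.+1.
  by case: (leqP n' n) => /half_le; [left|right].
case/andP: nt => t0 tn; have [ln pn'] := (half_le1 n, half_gt0 n').
move: near' tn ln pn' hab; rewrite /side_point /bad_point (halfS n).
move: (half n.+1) (half n') => a b near' ta a1 b0 hab.
case: s near'; case: e; case: s'; case: e'; rewrite /near_pt /= !ltr_distl;
  move=> [/andP[? ?] /andP[? ?]]; try lra.
all: by case: hab => ?; lra.
Qed.

Lemma half_near1 m N : 1 - half m < half N.+1 -> m = 0%N.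
Proof.
case: m => // m; have := half_le1 m; have := half_le1 N.
by rewrite (halfS m) (halfS N) => ? ? ?; exfalso; lra.
Qed.

(** Distinct powers of 1/2, the larger being 2^-m, differ by at least 2^-(m+1). *)
Lemma half_near_half m m' N :
  half m - half m' < half N.+1 -> half m' - half m < half N.+1 ->
  m = m' \/ (N.+1 <= m)%N /\ (N.+1 <= m')%N.
Proof.
wlog mm' : m m' / (m <= m')%N => [gen|] h h'.
  case: (leqP m m') => [/gen|/ltnW/gen]; first exact.
  by case=> // [->|[? ?]]; [left|right].
move: mm'; rewrite leq_eqVlt => /orP[/eqP|lt]; [by left|right].
have /half_lt : half m.+1 < half N.+1 by have := half_le lt; have := halfS m; lra.
by rewrite ltnS => Nm; split=> //; exact: leq_trans Nm (ltnW lt).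
Qed.

(* The corner [(0, 1)] is indexed by [false], the corner [(1, 0)] by [true]; the
   bad points [bad_point s e n] converge to the corner [s (+) e]. *)
Lemma near_bad_overlap N p s e n s' e' n' :
  near_pt (half N.+2) (bad_point s e n) p ->
  near_pt (half N.+2) (bad_point s' e' n') p ->
  [\/ [/\ s = s', e = e' & n = n'], [/\ e = e', n = 0%N & n' = 0%N] |
      [/\ s (+) e = s' (+) e', (N.+1 <= n)%N & (N.+1 <= n')%N]].
Proof.
rewrite /near_pt !ltr_distl => -[/andP[p1 p1'] /andP[p2 p2']] [/andP[q1 q1'] /andP[q2 q2']].
(* Centres of two overlapping cells differ by less than twice the radius, that is 2^-(N+1), in each
   coordinate. *)
have hN := halfS N.+1; have pN := half_gt0 N.+2; have lN := half_le1 N.+1.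
have [pn pn'] := (half_gt0 n, half_gt0 n').
move: p1 p1' p2 p2' q1 q1' q2 q2'; case: s; case: e; case: s'; case: e' => /= *; try lra.
all: try by apply: Or33; split=> //; apply/ltnW/half_lt; lra.
all: try by apply: Or32; split=> //; apply: (@half_near1 _ N); lra.
all: by case: (@half_near_half n n' N) => [||->|[? ?]]; [lra|lra|apply: Or31|apply: Or33].
Qed.

Definition corner_point (b : bool) eps : R * R :=
  if b then (1 - eps / 2, eps / 2) else (eps / 2, 1 - eps / 2).

Lemma corner_polygon b eps : 0 < eps <= 1 -> @polygon R (corner_point b eps).
Proof.
by move=> /andP[? ?]; left; case: b; split; apply/andP; split => /=; lra.
Qed.

(** One point common to all cells of large index at a corner; it puts them all in one component. *)
Lemma near_corner s e n N : (N <= n)%N ->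
  near_pt (half N) (bad_point s e n) (corner_point (s (+) e) (half N)).
Proof.
move=> /half_le; have [pn pN] := (half_gt0 n, half_gt0 N).
by case: s; case: e => /= ?; rewrite /near_pt /= !ltr_distl;
  split; apply/andP; split; lra.
Qed.

Lemma side_range_mid eps n : 0 < eps <= 1 ->
  side_range n (half n.+1 * eps / 2) /\ half n.+1 * eps / 2 < eps.
Proof.
move=> /andP[e0 e1]; have [p l] := (half_gt0 n.+1, half_le1 n.+1).
by split; [apply/andP; split|]; nra.
Qed.

Lemma side_range_mid' eps n : 0 < eps <= 1 ->
  side_range n (half n.+1 - half n.+1 * eps / 2) /\ half n.+1 * eps / 2 < eps.
Proof.
move=> /andP[e0 e1]; have [p l] := (half_gt0 n.+1, half_le1 n.+1).
by split; [apply/andP; split|]; nra.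
Qed.

Definition far_set eps : set (R * R) :=
  [set p | [/\ 0 <= p.1 <= 1, 0 <= p.2 <= 1 &
     forall s e n, ~ near_pt eps (bad_point s e n) p]].

(** A boundary point of the closed square outside the polygon is a bad point or one of the corners
    (0,1), (1,0), where bad points accumulate; neither is far from all bad points. *)
Lemma far_polygon eps : 0 < eps -> far_set eps `<=` @polygon R.
Proof.
move=> e0 [u v] [/= /andP[u0 u1] /andP[v0 v1] far].
have lo s v' : 0 <= v' <= 1 -> coord s 0 v' = (u, v) -> @polygon R (u, v).
  move=> /andP[v'0 v'1] uv.
  have near_lo n : v' - (1 - half n) < eps -> (1 - half n) - v' < eps -> False.
    move=> ? ?; apply: (far s false n); rewrite -uv /near_pt.
    by case: s {uv far}; rewrite /= !ltr_distl; split; apply/andP; split; lra.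
  (* Bounds [v'] away from the accumulation corner; the least index [n] with [v'] below [1 - half n]
     then locates its segment. *)
  have [m m_small] := half_small e0.
  have vm : v' < 1 - half m.
    by rewrite ltNge; apply/negP => ?; apply: (near_lo m); lra.
  have exn : exists n, v' < 1 - half n by exists m.
  have [[|n] ltn minn] := ex_minnP exn.
    by move: ltn; rewrite expr0 invr1; lra.
  have len : 1 - half n <= v'.
    by rewrite leNgt; apply/negP => /minn; rewrite ltnn.
  have neq : 1 - half n != v'.
    by apply/negP => /eqP nv; apply: (near_lo n); rewrite nv subrr.
  rewrite -uv; have -> : coord s 0 v' = side_point s false n (v' - (1 - half n)).
    by rewrite /side_point /=; congr coord; ring.
  apply: side_point_polygon; move: neq len ltn; rewrite (halfS n) => neq len ltn.
  by apply/andP; split; [rewrite subr_gt0 lt_neqAle neq|lra].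
have hi s v' : 0 <= v' <= 1 -> coord s 1 v' = (u, v) -> @polygon R (u, v).
  move=> /andP[v'0 v'1] uv.
  have near_hi n : v' - half n < eps -> half n - v' < eps -> False.
    move=> ? ?; apply: (far s true n); rewrite -uv /near_pt.
    by case: s {uv far}; rewrite /= !ltr_distl; split; apply/andP; split; lra.
  have [m m_small] := half_small e0.
  have vm : half m < v'.
    by rewrite ltNge; apply/negP => ?; apply: (near_hi m); have := half_gt0 m; lra.
  have exn : exists n, half n < v' by exists m.
  have [[|n] ltn minn] := ex_minnP exn.
    by move: ltn; rewrite expr0 invr1; lra.
  have len : v' <= half n.
    by rewrite leNgt; apply/negP => /minn; rewrite ltnn.
  have neq : v' != half n.
    by apply/negP => /eqP nv; apply: (near_hi n); rewrite nv subrr.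
  rewrite -uv; have -> : coord s 1 v' = side_point s true n (v' - half n.+1).
    by rewrite /side_point /=; congr coord; ring.
  have ltn' : v' < half n by rewrite lt_neqAle neq.
  apply: side_point_polygon; move: ltn'; rewrite (halfS n) => ltn'.
  by apply/andP; split; lra.
have [u_eq0|u_neq0] := eqVneq u 0.
  by apply: (lo false v); [rewrite v0|rewrite u_eq0].
have [v_eq0|v_neq0] := eqVneq v 0.
  by apply: (lo true u); [rewrite u0|rewrite v_eq0].
have [u_eq1|u_neq1] := eqVneq u 1.
  by apply: (hi false v); [rewrite v0|rewrite u_eq1].
have [v_eq1|v_neq1] := eqVneq v 1.
  by apply: (hi true u); [rewrite u0|rewrite v_eq1].
by left; split; rewrite /= !lt_neqAle ?u0 ?v0 ?u1 ?v1 ?u_neq1 ?v_neq1 1?eq_sym ?u_neq0 ?v_neq0.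
Qed.

Lemma far_compact eps : compact (far_set eps).
Proof.
have -> : far_set eps = (`[0, 1]%classic `*` `[0, 1]%classic) `&`
    ~` (\bigcup_(i in [set: bool * bool * nat])
          [set p | near_pt eps (bad_point i.1.1 i.1.2 i.2) p]).
  apply/seteqP; split=> p /=.
    move=> [p1 p2 far]; split; first by rewrite /= !in_itv.
    by move=> [[[s e] n] _ /=]; exact: far.
  rewrite !in_itv => -[[p1 p2] far]; split=> // s e n pn; apply: far.
  by exists (s, e, n).
apply: compact_closedI.
  by apply: compact_setX; exact: segment_compact.
rewrite closedC; apply: bigcup_open => i _; exact: near_pt_open.
Qed.

(** The radius is the distance to the boundary of the square for an interior point, and to the
    nearer end of its own segment for a boundary point. *)
Lemma polygon_far p : @polygon R p -> exists2 eps, 0 < eps &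
  forall s e n, ~ near_pt eps (bad_point s e n) p.
Proof.
case/polygonP => [[/andP[? ?] /andP[? ?]]|].
  exists (Num.min (Num.min p.1 (1 - p.1)) (Num.min p.2 (1 - p.2))).
    by rewrite !lt_min; apply/andP; split; apply/andP; split; lra.
  set d := Num.min _ _; have [d1 d2 d3 d4] : [/\ d <= p.1, d <= 1 - p.1, d <= p.2 & d <= 1 - p.2].
    by rewrite /d; split; rewrite !ge_min lexx ?orbT.
  move=> s e n; case: s; case: e; rewrite /near_pt /= !ltr_distl;
    by move=> [/andP[? ?] /andP[? ?]]; lra.
move=> [s [e [n [t [nt ->]]]]].
have eps0 : 0 < Num.min t (half n.+1 - t).
  by rewrite lt_min; case/andP: nt => ? ?; apply/andP; split; lra.
exists (Num.min t (half n.+1 - t)) => // s' e' n' /(side_near_end nt).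
rewrite (side_near nt eps0 erefl) (side_nearS nt eps0 erefl) !lt_min !ltxx.
by rewrite andbF; case: e; case.
Qed.

End Polygon.

(** * Counting ends *)

Section EndCount.
Variables (Y : topologicalType) (I : finType) (K : nat -> set Y).
Variable z : nat -> I -> Y.
Hypothesis K_compact : forall N, compact (K N).
Hypothesis K_mono : forall N, K N `<=` K N.+1.
Hypothesis K_exhausts : forall C, compact C -> exists N, C `<=` K N.
Hypothesis z_notin : forall N i, (~` K N) (z N i).
Hypothesis z_components : forall N y, (~` K N) y ->
  exists i, connected_component (~` K N) (z N i) y.

Let Kc N : {C : set Y | compact C} := exist _ (K N) (@K_compact N).

Lemma exhaustion_le N M : (N <= M)%N -> K N `<=` K M.
Proof.
move/subnKC <-; elim: (M - N)%N => [|k IH]; first by rewrite addn0.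
by move=> y Ky; rewrite addnS; apply: K_mono; exact: IH.
Qed.

Lemma component_eq (A : set Y) x y w : connected_component A x w ->
  connected_component A y w -> connected_component A x = connected_component A y.
Proof.
move=> /same_connected_component -> /same_connected_component ->; exact: erefl.
Qed.

Lemma end_component (e : {C : set Y | compact C} -> set Y) C y : ends e -> e C y ->
  e C = connected_component (~` sval C) y.
Proof. by move=> [/(_ C)[w _ ->] _] /same_connected_component. Qed.

Lemma end_nonempty (e : {C : set Y | compact C} -> set Y) C : ends e -> e C !=set0.
Proof.
by move=> [/(_ C)[w Cw ->] _]; exists w; exact: connected_component_refl.
Qed.

(** Distinct ends differ at some level, and one level serves all finitely many pairs. The |I|
    components found there each contain some base point [z N i], so by counting the base points lie
    in distinct components. *)
Lemma ends_separate_components : has_n_ends #|I| Y ->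
  exists N, injective (fun i => connected_component (~` K N) (z N i)).
Proof.
rewrite /has_n_ends card_eq_sym => /card_set_bijP[E [EF Einj _]].
have EP (j : 'I_#|I|) : ends (E j) by apply: EF => /=; exact: ltn_ord.
have EI (j : 'I_#|I|) : (j : nat) \in `I_#|I| by rewrite inE /=.
have sep (jk : 'I_#|I| * 'I_#|I|) : exists N, jk.1 <> jk.2 ->
    E jk.1 (Kc N) <> E jk.2 (Kc N).
  case: jk => j k /=; have [->|/eqP jk] := eqVneq j k; first by exists 0%N.
  have [C jkC] : exists C, E j C <> E k C.
    apply/existsNP => jkC; apply: jk; apply: val_inj.
    by apply: Einj; [exact: EI|exact: EI|exact/funext].
  have [N CN] := K_exhausts (svalP C); exists N => _ jkN; apply: jkC.
  have [y Ejy] := end_nonempty (Kc N) (EP j).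
  have jC : E j C y by apply: (EP j).2 Ejy.
  have kC : E k C y by apply: (EP k).2 (_ : E k (Kc N) y) => //; rewrite -jkN.
  by rewrite (end_component (EP j) jC) (end_component (EP k) kC).
have [Nf Nfsep] := choice sep.
pose N := (\max_jk Nf jk)%N; exists N.
have Esep (j k : 'I_#|I|) : E j (Kc N) = E k (Kc N) -> j = k.
  move=> jkN; have [//|/eqP/= jk] := eqVneq j k.
  case: (Nfsep (j, k) jk) => /=.
  have le : K (Nf (j, k)) `<=` K N by apply: exhaustion_le; exact: leq_bigmax.
  have [y Ejy] := end_nonempty (Kc N) (EP j).
  have jC : E j (Kc (Nf (j, k))) y by apply: (EP j).2 Ejy.
  have kC : E k (Kc (Nf (j, k))) y.
    by apply: (EP k).2 (_ : E k (Kc N) y) => //; rewrite -jkN.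
  by rewrite (end_component (EP j) jC) (end_component (EP k) kC).
have gam (j : 'I_#|I|) : exists i, E j (Kc N) = connected_component (~` K N) (z N i).
  have [y Ejy] := end_nonempty (Kc N) (EP j).
  have EN := end_component (EP j) Ejy.
  have /z_components[i iy] : (~` K N) y.
    by apply: (@connected_component_sub _ _ y); rewrite -[X in X y]EN.
  exists i; rewrite EN; apply: component_eq iy.
  by apply: connected_component_refl; apply: (@connected_component_sub _ _ y); rewrite -[X in X y]EN.
have [f fE] := choice gam.
have finj : injective f by move=> j k jk; apply: Esep; rewrite !fE jk.
have fbij : bijective f by apply: inj_card_bij => //; rewrite card_ord.
case: fbij => f' _ f'K i i' ii'.
by rewrite -(f'K i) -(f'K i'); congr f; apply: Esep; rewrite !fE !f'K.
Qed.

(** * Ends counted by a partition of the complements into open colours *)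

Section Coloured.
Variables (F : nat -> I -> set Y) (N0 : nat).
Hypothesis F_open : forall N i, (N0 <= N)%N -> open (F N i).
Hypothesis F_disjoint : forall N i j y, (N0 <= N)%N -> F N i y -> F N j y -> i = j.
Hypothesis F_cover : forall N y, (N0 <= N)%N -> (~` K N) y -> exists i, F N i y.
Hypothesis F_mono : forall N i, F N.+1 i `<=` F N i.
Hypothesis F_sub : forall N i, F N i `<=` ~` K N.
Hypothesis F_z : forall N i, (N0 <= N)%N -> F N i (z N i).

Lemma connected_in_colour N i y (A : set Y) : (N0 <= N)%N -> connected A ->
  A `<=` ~` K N -> A y -> F N i y -> A `<=` F N i.
Proof.
move=> NN cA AK Ay Fy.
suff <- : A `&` F N i = A by apply: subIsetr.
apply: cA; first by exists y.
  by exists (F N i) => //; exact: F_open.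
exists (~` \bigcup_(j in [set j | j != i]) F N j).
  by rewrite closedC; apply: bigcup_open => j _; exact: F_open.
apply/seteqP; split=> w [Aw].
  by move=> Fw; split=> // -[j /= /eqP ji Fj]; apply: ji; exact: F_disjoint Fj Fw.
move=> nF; split=> //; have [j Fj] := F_cover NN (AK _ Aw).
by have [<-//|ji] := eqVneq j i; exfalso; apply: nF; exists j.
Qed.

(** A component has a single colour, and a point of colour [i] shares its component with some base
    point, which must then be the [i]-th. *)
Lemma colour_component N i : (N0 <= N)%N ->
  connected_component (~` K N) (z N i) = F N i.
Proof.
move=> NN; apply/seteqP; split.
  apply: (connected_in_colour NN (y := z N i)).
  - exact: component_connected.
  - exact: connected_component_sub.
  - by apply: connected_component_refl; exact: z_notin.
  - exact: F_z.
move=> y Fy; have [j zy] := z_components (F_sub Fy).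
suff -> : i = j by [].
apply: (F_disjoint NN Fy); apply: (connected_in_colour NN (y := z N j)) zy.
- exact: component_connected.
- exact: connected_component_sub.
- by apply: connected_component_refl; exact: z_notin.
- exact: F_z.
Qed.

Lemma colour_le N M i : (N <= M)%N -> F M i `<=` F N i.
Proof.
move/subnKC <-; elim: (M - N)%N => [|k IH]; first by rewrite addn0.
by rewrite addnS; apply: subset_trans IH; exact: F_mono.
Qed.

Let level (C : {C : set Y | compact C}) : {N | (N0 <= N)%N /\ sval C `<=` K N}.
Proof.
apply: cid; have [N CN] := K_exhausts (svalP C); exists (maxn N0 N).
split; first exact: leq_maxl.
by apply: subset_trans CN _; apply: exhaustion_le; exact: leq_maxr.
Qed.

(** The chosen level is immaterial: by [colour_end_sub] the component contains the [i]-th colour of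
    every admissible level. *)
Let colour_end i (C : {C : set Y | compact C}) : set Y :=
  connected_component (~` sval C) (z (sval (level C)) i).

Let colour_end_sub i C N : (N0 <= N)%N -> sval C `<=` K N -> F N i `<=` colour_end i C.
Proof.
move=> NN CN; rewrite /colour_end; case: (level C) => M [MM CM] /=.
have con L : (N0 <= L)%N -> connected (F L i).
  by move=> /colour_component <-; exact: component_connected.
have sub L : sval C `<=` K L -> F L i `<=` ~` sval C.
  by move=> CL y /F_sub; apply: contra_not => /CL.
have [NM|/ltnW MN] := leqP N M.
  apply: connected_component_max; [|exact: sub|exact: con].
  by apply: colour_le NM _ _; exact: F_z.
apply: subset_trans (colour_le MN) _.
by apply: connected_component_max; [exact: F_z|exact: sub|exact: con].
Qed.

Let colour_endP i : ends (colour_end i).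
Proof.
split=> [C|C D CD].
  exists (z (sval (level C)) i) => //; have [_ CM] := svalP (level C).
  by move/CM; exact: z_notin.
have [NN DN] := svalP (level D); set N := sval (level D) in NN DN.
have zC : colour_end i C (z N i).
  by apply: (colour_end_sub NN (subset_trans CD DN)); exact: F_z.
rewrite {1}/colour_end -/N => y zy; apply: connected_component_trans zC _.
have DC : ~` sval D `<=` ~` sval C by exact: subsetC.
apply: connected_component_max zy.
- by apply: connected_component_refl => /DN; exact: z_notin.
- exact: subset_trans (@connected_component_sub _ _ _) DC.
- exact: component_connected.
Qed.

Let colour_end_inj i j : colour_end i = colour_end j -> i = j.
Proof.
move=> ij; have sub : sval (Kc N0) `<=` K N0 by [].
have := colour_end_sub (leqnn N0) sub (F_z j (leqnn N0)).
have := colour_end_sub (leqnn N0) sub (F_z i (leqnn N0)).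
rewrite ij => zi zj.
have cmp l : colour_end l (Kc N0) = connected_component (~` K N0) (z N0 l).
  by apply: end_component (colour_endP l) _; apply: colour_end_sub (F_z l (leqnn N0)).
move: zi; rewrite cmp colour_component// => Fji.
exact: F_disjoint (leqnn N0) (F_z i (leqnn N0)) Fji.
Qed.

(** On each [K N] an end selects a colour; since colours shrink with the level, it is always the
    same one. *)
Let colour_end_onto e : ends e -> exists i, colour_end i = e.
Proof.
move=> eP.
have eF N : (N0 <= N)%N -> exists i, e (Kc N) = F N i.
  move=> NN; have [y ey] := end_nonempty (Kc N) eP.
  have eN := end_component eP ey.
  have Ky : (~` K N) y.
    by apply: (@connected_component_sub _ _ y); rewrite -[X in X y]eN.
  have [i zy] := z_components Ky; exists i.
  by rewrite eN -(same_connected_component zy) colour_component.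
have [i ei] := eF N0 (leqnn N0).
have eFi N : (N0 <= N)%N -> e (Kc N) = F N i.
  move=> NN; have [j ej] := eF N NN.
  suff -> : i = j by [].
  have [y ey] := end_nonempty (Kc N) eP.
  have /= := eP.2 (Kc N0) (Kc N) (exhaustion_le NN) y ey.
  rewrite ei => Fi; apply: (F_disjoint (leqnn N0) Fi).
  by apply: colour_le NN _ _; rewrite -ej.
exists i; apply/funext => C; have [NN CN] := svalP (level C).
set N := sval (level C) in NN CN.
have zN := F_z i NN.
rewrite (end_component (colour_endP i) (colour_end_sub NN CN zN)).
by apply/esym/(end_component eP)/(eP.2 C (Kc N) CN); rewrite eFi.
Qed.

Lemma coloured_ends : has_n_ends #|I| Y.
Proof.
rewrite /has_n_ends; have -> : @ends Y = range colour_end.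
  by apply/seteqP; split=> [e /colour_end_onto[i <-]|_ [i _ <-]]; [exists i|].
apply: (card_eq_trans (B := [set: I])).
  by apply: inj_card_eq => i j _ _; exact: colour_end_inj.
apply/card_set_bijP; exists (fun i => val (enum_rank i)); split.
- by move=> i _ /=.
- by move=> i j _ _ /val_inj/enum_rank_inj.
- by move=> k /= kI; exists (enum_val (Ordinal kI)) => //=; rewrite enum_valK.
Qed.

End Coloured.
End EndCount.

(** * Surfaces glued from labelled copies of the polygon *)

Section Labels.
Variables (G : zmodType) (h : int -> G).
Implicit Types (s e : bool) (n : nat).

(* Crossing the segment [n] of the side [s] from its high copy to its low copy
   adds [label s n] to the sheet: the loops [alpha n.+1] leave through the high
   side, the loops [beta n.+1] through the low side. *)
Definition label s n : G := if s then - h (- n.+1%:Z) else h n.+1%:Z.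

Definition shift e (l : G) : G := if e then l else - l.

Lemma shiftN e l : shift (~~ e) l = - shift e l.
Proof. by case: e; rewrite /= ?opprK. Qed.

(* The total label of the path that turns around the bad points
   [bad_point s e n], [bad_point s (~~ e) n.-1], ... down to a bad point of
   index 0. *)
Fixpoint walk s e n : G :=
  if n is n'.+1 then shift e (label s n') + walk s (~~ e) n' else 0.

Lemma walkN s e n : walk s (~~ e) n = - walk s e n.
Proof. by elim: n e => [|n IH] e; rewrite /= ?oppr0// shiftN !IH -opprD. Qed.

(** The indices run from -(n+1) to n: the vertical walk collects the positive ones, the horizontal
    walk the negative ones. Raising [n] adds a term at each end and negates both walks, which the
    sign absorbs. *)
Lemma walk_sum n : h 0 = 0 ->
  \sum_(j < n.+1.*2) h (j%:Z - n.+1%:Z) *~ ((-1) ^ (j%:Z - n.+1%:Z)) =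
  (walk false true n + walk true true n.+1) *~ ((-1) ^ n%:Z).
Proof.
move=> h0; elim: n => [|n IH].
  rewrite big_ord_recl big_ord1 /= add0r addr0 h0 mul0rz !addr0.
  have -> : (-1 : int) ^ (- 1%:Z) = -1 by [].
  by rewrite sub0r expr0z mulr1z mulrNz mulr1z.
set w := walk false true n.+1 + walk true true n.+2.
rewrite doubleS big_ord_recl big_ord_recr /=.
have -> : \sum_(i < n.+1.*2) h ((bump 0 i)%:Z - n.+2%:Z) *~ (-1) ^ ((bump 0 i)%:Z - n.+2%:Z) =
    \sum_(j < n.+1.*2) h (j%:Z - n.+1%:Z) *~ ((-1) ^ (j%:Z - n.+1%:Z)).
  apply: eq_bigr => i _; have -> : (bump 0 i)%:Z - n.+2%:Z = i%:Z - n.+1%:Z by rewrite /bump; lia.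
  by [].
rewrite IH.
have -> : (bump 0 (n.+1.*2))%:Z - n.+2%:Z = n.+1%:Z by rewrite /bump; lia.
rewrite sub0r.
have -> : (-1 : int) ^ (- n.+2%:Z) = (-1) ^ n%:Z.
  by rewrite -exprz_inv invrN1 /exprz !exprS; ring.
have -> : (-1 : int) ^ n.+1%:Z = - (-1) ^ n%:Z by rewrite /exprz exprS mulN1r.
have -> : w = h n.+1%:Z - walk false true n + (- h (- n.+2%:Z) - walk true true n.+1).
  by rewrite -!walkN.
move: (walk false true n) (walk true true n.+1) => u v.
rewrite !mulrNz !mulrzDl !mulNrz !opprD !opprK.
by rewrite [RHS](AC (2*2) (3*((2*4)*1)))%AC.
Qed.

End Labels.

Section Atlas.
Variables (R : realType) (G : finZmodType) (h : int -> G) (Y : topologicalType).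
Variable Phi : G -> @polygon R -> Y.

Local Notation half n := (2 ^- n : R).
Local Notation cell_at N s e n := (@cell R (half N.+2) (bad_point R s e n)).

(** States that [Y] is the quotient of the copies of the polygon indexed by [G], with the final
    topology and no identifications besides the labelled gluings. *)
Record labelled_atlas : Prop := LabelledAtlas {
  atlas_continuous : forall g, continuous (Phi g);
  atlas_onto : forall y, exists g x, Phi g x = y;
  atlas_open : forall W, (forall g, open (Phi g @^-1` W)) -> open W;
  atlas_glue : forall g s n t, side_range n t ->
    Phi g (to_polygon (side_point s true n t)) =
    Phi (g + label h s n) (to_polygon (side_point s false n t));
  atlas_separated : forall g g' x x', Phi g x = Phi g' x' ->
    (x = x' /\ g = g') \/ exists s e n t, [/\ side_range n t,
      set_val x = side_point s e n t, set_val x' = side_point s (~~ e) n t &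
      g' = g + shift e (label h s n)] }.

Hypothesis atlas : labelled_atlas.

Lemma atlas_side g s e n t : side_range n t ->
  Phi g (to_polygon (side_point s e n t)) =
  Phi (g + shift e (label h s n)) (to_polygon (side_point s (~~ e) n t)).
Proof.
move=> nt; case: e; first exact: (atlas_glue atlas).
by rewrite (atlas_glue atlas _ _ nt) subrK.
Qed.

Lemma near_glued_ends s e n t (eps : R) s' e' n' : side_range n t ->
  near_pt eps (bad_point R s' e' n') (side_point s e n t) ->
  exists i j, [/\ (i = n /\ j = n.+1) \/ (i = n.+1 /\ j = n),
    near_pt eps (bad_point R s e i) (side_point s e n t) &
    near_pt eps (bad_point R s (~~ e) j) (side_point s (~~ e) n t)].
Proof.
move=> nt nearb; have e0 : 0 < eps by case: nearb => h' _; apply: le_lt_trans h'.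
have [ne|ne] := side_near_end nt nearb.
  exists n, n.+1; split=> //; first by left.
  apply/(side_nearS nt e0 erefl); move/(side_near nt e0 erefl): ne.
  by case: e {nearb}.
exists n.+1, n; split=> //; first by right.
apply/(side_near nt e0 erefl); move/(side_nearS nt e0 erefl): ne.
by case: e {nearb}.
Qed.

Definition far (r : R) : set (@polygon R) :=
  [set x | forall s e n, ~ near_pt r (bad_point R s e n) (set_val x)].

(** A side point near a bad point has a partner near a bad point as well, so being far is well
    defined on [Y]. *)
Lemma far_glued r g g' x x' : Phi g x = Phi g' x' -> far r x -> far r x'.
Proof.
move=> /(atlas_separated atlas)[[<-//]|[s [e [n [t [nt xE x'E _]]]]]] farx.
move=> s' e' n'; rewrite x'E => /(near_glued_ends nt)[i [j [_ _]]].
by rewrite negbK -xE; exact: farx.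
Qed.

Definition end_region N : set Y :=
  [set y | exists g s e n x, cell_at N s e n x /\ Phi g x = y].

Lemma end_regionC N : ~` end_region N =
  \bigcup_(g in [set: G]) Phi g @` far (half N.+2).
Proof.
apply/seteqP; split=> [y nUy|_ [g _ [x farx <-]]].
  have [g [x gx]] := atlas_onto atlas y; exists g => //; exists x => // s e n bx.
  by apply: nUy; exists g, s, e, n, x.
move=> [g' [s [e [n [x' [bx' /esym gx]]]]]].
exact: (far_glued gx farx) bx'.
Qed.

Lemma far_polygon_compact N : compact (far (half N.+2)).
Proof.
have -> : far (half N.+2) = set_val @^-1` far_set (half N.+2).
  apply/seteqP; split=> x farx; last by case: farx.
  by have [] := polygon_square (polygon_val x); split.
by apply: compact_preimage (@far_compact _ _); apply: far_polygon; exact: half_gt0.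
Qed.

Lemma end_regionC_compact N : compact (~` end_region N).
Proof.
rewrite end_regionC.
have -> : \bigcup_(g in [set: G]) Phi g @` far (half N.+2) =
    \big[setU/set0]_(g <- enum G) (Phi g @` far (half N.+2)).
  rewrite -bigcup_seq; congr bigcup; apply/seteqP; split=> // g _ /=.
  by rewrite mem_enum.
apply: bigsetU_compact => g _; apply: continuous_compact.
  by apply: continuous_subspaceT; exact: (atlas_continuous atlas).
exact: far_polygon_compact.
Qed.

Lemma end_region_mono N : end_region N.+1 `<=` end_region N.
Proof.
move=> _ [g [s [e [n [x [[b1 b2] <-]]]]]]; exists g, s, e, n, x; split=> //.
by split; apply: lt_le_trans (half_le R (leqnSn N.+2)).
Qed.

Lemma end_region_exhausts C : compact C -> exists N, C `<=` ~` end_region N.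
Proof.
(* The slack [r] above the radius of the cells makes these sets open; together they cover [Y]. *)
pose W N : set Y := [set y | exists g x,
  Phi g x = y /\ exists2 r, half N.+2 < r & far r x].
have W_open N : open (W N).
  apply: (atlas_open atlas) => g; rewrite openE => x [g' [x' [gx [r Nr farx']]]].
  have farx : far r x := far_glued gx farx'.
  pose d := (r - half N.+2) / 2; have d0 : 0 < d by rewrite divr_gt0// subr_gt0.
  have nx : nbhs x (cell d (set_val x)).
    apply: open_nbhs_nbhs; split; first exact: cell_open.
    by split; rewrite subrr normr0.
  apply: filterS nx => z [z1 z2]; exists g, z; split=> //.
  exists (half N.+2 + d); first by rewrite ltrDl.
  move=> s e n [b1 b2]; apply: (farx s e n); move: z1 z2 b1 b2.
  rewrite /near_pt /d !ltr_distl => /andP[? ?] /andP[? ?] /andP[? ?] /andP[? ?].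
  by split; apply/andP; split; lra.
have WK N M : (N <= M)%N -> W N `<=` ~` end_region M.
  move=> NM _ [g [x [<- [r Nr farx]]]]; rewrite end_regionC; exists g => //.
  exists x => // s e n [b1 b2]; apply: (farx s e n).
  have Mr : half M.+2 < r by apply: le_lt_trans Nr; exact: half_le.
  by split; apply: lt_trans Mr.
have W_cover y : exists N, W N y.
  have [g [x gx]] := atlas_onto atlas y.
  have [r r0 farx] := polygon_far (polygon_val x).
  have [N Nr] := half_small r0; exists N, g, x; split=> //; exists r => //.
  by apply: le_lt_trans Nr; apply: half_le; rewrite -addn2 leq_addr.
(* Compactness along [N] tending to infinity: a level valid near each point gives one valid on all
   of [C]. *)
move=> /compact_near_coveringP/(_ nat \oo (fun N y => ~ end_region N y)).
have oo : Filter \oo by exact: eventually_filter.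
move=> /(_ oo)[y Cy|N _ CN]; last by exists N => y Cy; exact: (CN N (leqnn N)).
have [N WN] := W_cover y.
exists (W N, [set M | (N <= M)%N]) => /=.
  by split; [exact: open_nbhs_nbhs|exists N].
by case=> y' M /= [Wy' NM]; exact: (WK N M).
Qed.

Lemma eps01 N : 0 < half N.+2 <= 1.
Proof. by rewrite half_gt0 half_le1. Qed.

(* All the components in this union agree, see [nodeE]. *)
Definition node N g s e n : set Y :=
  \bigcup_(x in cell_at N s e n) connected_component (end_region N) (Phi g x).

Lemma nodeE N g s e n x : cell_at N s e n x ->
  node N g s e n = connected_component (end_region N) (Phi g x).
Proof.
move=> bx; apply/seteqP; split=> [y [x' bx' yx']|y xy]; last by exists x.
apply: connected_component_trans yx'.
exists (Phi g @` cell_at N s e n); last by exists x'.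
split; first by exists x.
  by move=> _ [w bw <-]; exists g, s, e, n, w.
apply: connected_continuous_connected; first exact/cell_connected/eps01.
by apply: continuous_subspaceT; exact: (atlas_continuous atlas).
Qed.

(** A point of the segment [n] close to its end [n.+1] is glued to a point close to the end [n] of
    the opposite side: one link of a chain. *)
Lemma node_step N g s e n :
  node N g s e n.+1 = node N (g + shift e (label h s n)) s (~~ e) n.
Proof.
have e0 : 0 < half N.+2 by exact: half_gt0.
have [t nt te] : exists2 t, side_range n t &
    near_pt (half N.+2) (bad_point R s e n.+1) (side_point s e n t).
  have [nt mt] := side_range_mid n (eps01 N); have [nt' _] := side_range_mid' n (eps01 N).
  case: e.
    by eexists; first exact: nt; apply/(side_nearS nt e0 erefl).
  by eexists; first exact: nt'; apply/(side_nearS nt' e0 erefl); rewrite opprB addrC subrK.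
have te' : near_pt (half N.+2) (bad_point R s (~~ e) n) (side_point s (~~ e) n t).
  by apply/(side_near nt e0 erefl); move/(side_nearS nt e0 erefl): te; case: e.
rewrite (@nodeE N _ s e n.+1 (to_polygon (side_point s e n t))).
  rewrite (@nodeE N _ s (~~ e) n (to_polygon (side_point s (~~ e) n t))).
    by rewrite (atlas_side _ _ _ nt).
  by rewrite /cell /= to_polygonK//; exact: side_point_polygon.
by rewrite /cell /= to_polygonK//; exact: side_point_polygon.
Qed.

Lemma node_walk N g s e n :
  node N g s e n = node N (g + walk h s e n) s (e (+) odd n) 0.
Proof.
elim: n g e => [|n IH] g e; first by rewrite /= addr0 addbF.
by rewrite node_step IH /= addrA; congr node; case: e; case: odd.
Qed.

(** The bad point of index 0 is a corner of the square common to a vertical and a horizontal side;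
    here the two kinds of chains are joined. *)
Lemma node0 N g s s' e : node N g s e 0 = node N g s' e 0.
Proof.
by rewrite /node /cell /bad_point /=; case: s; case: s'; case: e => //;
  rewrite /= ?expr0 ?invr1 ?subrr.
Qed.

Definition corner_base N b g : Y := Phi g (to_polygon (corner_point b (half N.+2))).

Lemma corner_cell N s e n : (N.+2 <= n)%N ->
  cell_at N s e n (to_polygon (corner_point (s (+) e) (half N.+2))).
Proof.
move=> Nn; have cP := @corner_polygon R (s (+) e) (half N.+2) (eps01 N).
by rewrite /cell /mkset to_polygonK//; exact: near_corner.
Qed.

Lemma node_corner N g s e n : (N.+2 <= n)%N ->
  node N g s e n = connected_component (end_region N) (corner_base N (s (+) e) g).
Proof.
by move=> Nn; apply: nodeE; exact: corner_cell.
Qed.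

Lemma corner_base_region N b g : end_region N (corner_base N b g).
Proof.
exists g, false, b, N.+2, (to_polygon (corner_point b (half N.+2))); split=> //.
exact: (@corner_cell N false b N.+2 (leqnn _)).
Qed.

Lemma node_up N g s e n k : exists g', node N g s e n = node N g' s (e (+) odd k) (n + k).
Proof.
elim: k => [|k [g' IH]]; first by exists g; rewrite /= addbF addn0.
exists (g' - shift (e (+) odd k.+1) (label h s (n + k))).
by rewrite addnS node_step subrK IH; congr node => /=; case: (e); case: odd.
Qed.

Lemma end_region_component N y : end_region N y ->
  exists g, connected_component (end_region N) (corner_base N false g) y.
Proof.
move=> [g [s [e [n [x [bx gx]]]]]].
(* Far enough to reach the cells around a corner, with one more step if needed for the parity that
   leads to (0,1). *)
pose k := (N.+2 + (odd N.+2 (+) (s (+) e)))%N.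
have [g' ng'] := node_up N g s e n k; exists g'.
have -> : connected_component (end_region N) (corner_base N false g') = node N g s e n.
  have sk : s (+) (e (+) odd k) = false by rewrite /k oddD; case: (s); case: (e); case: (odd N.+2).
  rewrite ng' node_corner ?sk//.
  by rewrite /k addnCA leq_addr.
rewrite (nodeE _ bx) -gx; apply: connected_component_refl.
by exists g, s, e, n, x.
Qed.

Lemma ends_atlas_separate : has_n_ends #|G| Y ->
  exists N, injective (fun g => connected_component (end_region N) (corner_base N false g)).
Proof.
move=> /(@ends_separate_components Y G (fun N => ~` end_region N)
  (fun N g => corner_base N false g)) [].
- exact: end_regionC_compact.
- by move=> N; apply: subsetC; exact: end_region_mono.
- exact: end_region_exhausts.
- by move=> N y; rewrite setCK; exact: end_region_component.
- by move=> N inj; exists N => g g'; have := inj g g'; rewrite setCK.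
Qed.

Definition vector_condition : Prop := exists2 N : nat, (0 < N)%N &
  \sum_(j < N.*2) h (j%:Z - N%:Z) *~ ((-1) ^ (j%:Z - N%:Z)) = 0 /\
  forall n : nat, (N <= n)%N ->
    [/\ h (- n%:Z) = h (- N%:Z), h (- N%:Z) = h N%:Z & h N%:Z = h n%:Z].

Lemma ends_condition : h 0 = 0 -> has_n_ends #|G| Y -> vector_condition.
Proof.
move=> h0 /ends_atlas_separate[N inj]; pose C b g :=
  connected_component (end_region N) (corner_base N b g).
have Cinj g g' : C false g = C false g' -> g = g' by exact: inj.
have nodeC g s e n : (N.+2 <= n)%N -> node N g s e n = C (s (+) e) g.
  exact: node_corner.
(* Both ends of a far segment belong to corner cells, and crossing it changes the corner. *)
have stepC g s e n : (N.+2 <= n)%N ->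
    C (s (+) e) g = C (~~ (s (+) e)) (g + shift e (label h s n)).
  move=> Nn; rewrite -(nodeC _ _ _ n.+1); last exact: leqW.
  by rewrite node_step nodeC// addbN.
(* Leaving (0,1) across one far segment and returning across another must end in the same sheet.
   With [e] equal to [s], the shift is minus the entry of [h] on both kinds of sides. *)
have label_eq s n s' n' : (N.+2 <= n)%N -> (N.+2 <= n')%N ->
    shift s (label h s n) = shift s' (label h s' n').
  move=> Nn Nn'; have := stepC 0 s s n Nn; rewrite addbb => C0.
  have := stepC (shift s (label h s n)) s' (~~ s') n' Nn'.
  rewrite addbN addbb /= shiftN -[in LHS](add0r (shift s _)) -C0.
  by move/Cinj/esym/eqP; rewrite subr_eq0 => /eqP.
(* Two chains start at (0,1), a vertical one in sheet 0 and a horizontal one in the sheet chosen so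
   that both reach the same node at index 0. Their starting sheets must then coincide. *)
have walk0 : walk h false true N.+2 + walk h true true N.+3 = 0.
  have C0 := nodeC 0 false false N.+2 (leqnn _).
  have := nodeC (- walk h false true N.+2 - walk h true true N.+3) true true N.+3 (leqnSn _).
  rewrite node_walk add0r (walkN h false true) (node0 _ _ false true) in C0.
  rewrite node_walk subrK.
  have -> : true (+) odd N.+3 = false (+) odd N.+2 by rewrite /= !negbK.
  rewrite C0 => /Cinj/eqP.
  by rewrite eq_sym -opprD oppr_eq0 => /eqP.
(* [walk_sum] at [N.+2] computes the sum whose indices start at -(N+3). *)
exists N.+3 => //; split; first by rewrite walk_sum// walk0 mul0rz.
have h_eq b n b' n' : (N.+3 <= n)%N -> (N.+3 <= n')%N ->
    h (if b then - n%:Z else n%:Z) = h (if b' then - n'%:Z else n'%:Z).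
  case: n => // n; case: n' => // n'; rewrite !ltnS => Nn Nn'.
  by have := label_eq b n b' n' Nn Nn'; case: b; case: b' => /= /oppr_inj.
move=> n Nn; split.
- exact: (h_eq true n true N.+3).
- exact: (h_eq true N.+3 false N.+3).
- exact: (h_eq false N.+3 false n).
Qed.

(* Giving the neighbourhood of [bad_point s e n] in the sheet [g] the colour
   [g + phi s e n] is consistent with the gluing, so that the colours separate the
   ends. *)
Section Potential.
Variables (phi : bool -> bool -> nat -> G) (c : G) (N0 : nat).
Hypothesis phi0 : forall s s' e, phi s e 0 = phi s' e 0.
Hypothesis phiS : forall s e n,
  phi s e n.+1 = shift e (label h s n) + phi s (~~ e) n.
Hypothesis phi_corner : forall s e n, (N0 <= n)%N -> phi s e n = if s (+) e then c else 0.

Definition coloured N g : set Y := [set y | exists g' s e n x,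
  [/\ cell_at N s e n x, Phi g' x = y & g' + phi s e n = g]].

Lemma phi_overlap N p s e n s' e' n' : (N0 <= N.+1)%N ->
  near_pt (half N.+2) (bad_point R s e n) p ->
  near_pt (half N.+2) (bad_point R s' e' n') p -> phi s e n = phi s' e' n'.
Proof.
move=> NN b b'; case: (near_bad_overlap b b').
- by move=> [-> -> ->].
- by move=> [-> -> ->].
- move=> [se Nn Nn']; rewrite !phi_corner ?se//; exact: leq_trans NN _.
Qed.

(** The colour of a point depends neither on the cell, by [phi_overlap], nor on the copy of the
    polygon, since [phiS] cancels the change of sheet across a segment. *)
Lemma colouredE N g g' s e n x : (N0 <= N.+1)%N -> cell_at N s e n x ->
  coloured N g (Phi g' x) -> g' + phi s e n = g.
Proof.
move=> NN bx [g1 [s1 [e1 [n1 [x1 [bx1 /(atlas_separated atlas) xx1 <-]]]]]].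
case: xx1 => [[x1x ->]|[s2 [e2 [n2 [t [nt x1E xE ->]]]]]].
  by rewrite x1x in bx1; congr (_ + _); exact: phi_overlap bx bx1.
have [i [j [ij bi bj]]] : exists i j, [/\ (i = n2 /\ j = n2.+1) \/ (i = n2.+1 /\ j = n2),
    near_pt (half N.+2) (bad_point R s2 e2 i) (set_val x1) &
    near_pt (half N.+2) (bad_point R s2 (~~ e2) j) (set_val x)].
  by move: bx1; rewrite /cell /= x1E xE; exact: near_glued_ends.
rewrite (phi_overlap NN bx bj) (phi_overlap NN bx1 bi) -addrA; congr (_ + _).
case: ij => -[-> ->]; rewrite phiS// shiftN negbK addrA subrr add0r.
by [].
Qed.

Lemma coloured_open N g : (N0 <= N.+1)%N -> open (coloured N g).
Proof.
move=> NN; apply: (atlas_open atlas) => g'; rewrite openE => x /= colx.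
have [g1 [s [e [n [x1 [bx1 x1x _]]]]]] := colx.
have [s' [e' [n' bx]]] : exists s e n, cell_at N s e n x.
  case: (atlas_separated atlas x1x) => [[<- _]|[s2 [e2 [n2 [t [nt x1E xE _]]]]]].
    by exists s, e, n.
  move: bx1; rewrite /cell /= x1E => /(near_glued_ends nt)[i [j [_ _ bj]]].
  by exists s2, (~~ e2), j; rewrite xE.
have nx : nbhs x (cell_at N s' e' n') by apply: open_nbhs_nbhs; split; first exact: cell_open.
apply: filterS nx => z bz; exists g', s', e', n', z; split=> //.
exact: colouredE NN bx colx.
Qed.

Lemma coloured_ends_atlas : has_n_ends #|G| Y.
Proof.
apply: (@coloured_ends Y G (fun N => ~` end_region N)
  (fun N g => corner_base N false g) _ _ _ _ _ coloured N0).
- exact: end_regionC_compact.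
- by move=> N; apply: subsetC; exact: end_region_mono.
- exact: end_region_exhausts.
- by move=> N i; rewrite setCK; exact: corner_base_region.
- by move=> N y; rewrite setCK; exact: end_region_component.
- by move=> N g NN; apply: coloured_open; exact: leqW.
- move=> N g g' y NN [g1 [s [e [n [x [bx <- <-]]]]]].
  by apply: colouredE bx; exact: leqW.
- move=> N y NN; rewrite setCK => -[g [s [e [n [x [bx gx]]]]]].
  by exists (g + phi s e n), g, s, e, n, x.
- move=> N g y [g' [s [e [n [x [[b1 b2] gx gp]]]]]]; exists g', s, e, n, x; split=> //.
  by split; apply: lt_le_trans (half_le R (leqnSn N.+2)).
- move=> N g y [g' [s [e [n [x [bx gx _]]]]]]; rewrite setCK.
  by exists g', s, e, n, x.
- move=> N g NN.
  exists g, false, false, N.+2, (to_polygon (corner_point false (half N.+2))); split=> //.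
    exact: (@corner_cell N false false N.+2 (leqnn _)).
  by rewrite phi_corner ?addr0//; apply: leq_trans NN _; rewrite -addn2 leq_addr.
Qed.

End Potential.

Lemma condition_ends : h 0 = 0 -> vector_condition -> has_n_ends #|G| Y.
Proof.
move=> h0 [[//|n0] _ [sum0 hc]].
have walk0 : walk h false true n0 + walk h true true n0.+1 = 0.
  move: sum0; rewrite walk_sum//.
  have [->|->] : (-1 : int) ^ n0%:Z = 1 \/ (-1 : int) ^ n0%:Z = -1.
  - by rewrite /exprz -signr_odd; case: odd; [right|left].
  - by rewrite mulr1z.
  - by rewrite mulrNz mulr1z => /eqP; rewrite oppr_eq0 => /eqP.
pose c := h n0.+1%:Z; pose a := walk h false true n0.
(* The values of [phi] at index 0, forced by the values 0 and [c] wanted at index [n0] on the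
   vertical sides. The vanishing sum then gives the right values at index [n0.+1] on the horizontal
   sides. *)
pose base b := if b (+) odd n0 then c - a else a.
pose phi s e n := walk h s e n + base (e (+) odd n).
have phiS s e n : phi s e n.+1 = shift e (label h s n) + phi s (~~ e) n.
  by rewrite /phi /= addrA; congr (_ + base _); case: (e); case: odd.
apply: (@coloured_ends_atlas phi c n0.+1) => //.
have lab s e n : (n0 <= n)%N -> shift e (label h s n) = if s (+) e then c else - c.
  move=> nn; have [h1 h2 h3] := hc n.+1 nn.
  by case: s; case: e; rewrite /= /c ?opprK -?h3 // h1 h2.
have base0 : [/\ phi false false n0 = 0, phi false true n0 = c,
    phi true true n0.+1 = 0 & phi true false n0.+1 = c].
  have wt : walk h true true n0.+1 = - a by apply/eqP; rewrite -addr_eq0 addrC walk0.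
  rewrite /phi (walkN h false true) (walkN h true true) wt -/a /base.
  by split => /=; case: (odd n0); rewrite /= ?addNr ?opprK ?(addrC a) ?subrK.
have step n : (n0 < n)%N -> forall s e, phi s e n = if s (+) e then c else 0.
  elim: n => // n IH; rewrite ltnS leq_eqVlt => /orP[/eqP <-|nn] s e.
    have [f0 fc t0 tc] := base0.
    case: s; first by case: e; [exact: t0|exact: tc].
    by rewrite phiS lab//; case: e; rewrite /= ?f0 ?fc ?addr0 ?addNr.
  rewrite phiS lab ?(ltnW nn)// IH//; case: s; case: e; by rewrite /= ?addr0 ?addNr.
by move=> s e n nn; exact: step.
Qed.

End Atlas.

(** * The cover of a defining vector *)

Section PathLifts.
Variables (R : realType) (Y X : topologicalType) (p : Y -> X).
Hypothesis covp : is_covering p.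
Implicit Types (f : R -> X) (y : Y).

Definition lifts_to f y y' : Prop := exists g : R -> Y,
  [/\ {within `[0, 1], continuous g}, g 0 = y, g 1 = y' &
      forall t, 0 <= t <= 1 -> p (g t) = f t].

(** The anchor [t0] is arbitrary: 0 yields uniqueness of the end of a lift, 1 uniqueness of its
    start. *)
Lemma lifts_agree (g g' : R -> Y) t0 :
  {within `[0, 1], continuous g} -> {within `[0, 1], continuous g'} ->
  (forall t, 0 <= t <= 1 -> p (g t) = p (g' t)) ->
  0 <= t0 <= 1 -> g t0 = g' t0 -> forall t, 0 <= t <= 1 -> g t = g' t.
Proof.
move=> cg cg' pg t01 gt0 t t1.
rewrite -(clamp_id t1).
apply: (@unique_lifting _ _ _ covp R (g \o clamp (R := R)) (g' \o clamp (R := R)) t0).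
- exact: real_line_connected.
- exact: within_clamp.
- exact: within_clamp.
- by move=> s; apply: pg; exact: clamp01.
- by rewrite /= clamp_id.
Qed.

Lemma lifts_to_exists f y : {within `[0, 1], continuous f} -> p y = f 0 ->
  exists y', lifts_to f y y'.
Proof.
move=> cf yf; have [||g [cg g0 pg]] := path_lifting covp (c := f \o clamp (R := R)) (y := y).
- exact: within_clamp.
- by rewrite /= clamp_id ?lexx ?ler01.
- exists (g 1), g; split=> //; first exact: continuous_subspaceT.
  by move=> t t01; rewrite pg//= clamp_id.
Qed.

Lemma lifts_to_unique f y y' y'' : lifts_to f y y' -> lifts_to f y y'' -> y' = y''.
Proof.
move=> [g [cg g0 <- pg]] [g' [cg' g'0 <- pg']].
apply: (@lifts_agree g g' 0) => //; rewrite ?lexx ?ler01//; last by rewrite g0.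
by move=> t t01; rewrite pg ?pg'.
Qed.

Lemma lifts_to_inj f y z y' : lifts_to f y y' -> lifts_to f z y' -> y = z.
Proof.
move=> [g [cg <- g1 pg]] [g' [cg' <- g'1 pg']].
apply: (@lifts_agree g g' 1) => //; rewrite ?lexx ?ler01//; last by rewrite g1.
by move=> t t01; rewrite pg ?pg'.
Qed.

Lemma lifts_to_fiber f y y' : lifts_to f y y' -> p y = f 0 /\ p y' = f 1.
Proof. by move=> [g [_ <- <- pg]]; split; apply: pg; rewrite lexx ler01. Qed.

Lemma lifts_to_eq f f' y y' : (forall t, 0 <= t <= 1 -> f t = f' t) ->
  lifts_to f y y' -> lifts_to f' y y'.
Proof.
move=> ff' [g [cg g0 g1 pg]]; exists g; split=> // t t01.
by rewrite -ff'// pg.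
Qed.

End PathLifts.

Section Concatenation.
Variables (R : realType) (T : topologicalType).
Implicit Types f g : R -> T.

Lemma loop_concat_continuous f g : {within `[0, 1], continuous f} ->
  {within `[0, 1], continuous g} -> f 1 = g 0 ->
  {within `[0, 1], continuous (loop_concat f g)}.
Proof.
move=> cf cg fg.
have -> : `[0, 1]%classic = `[0, 2^-1]%classic `|` `[2^-1, 1]%classic :> set R.
  apply/seteqP; split=> r /=; rewrite !in_itv /=.
    by move=> /andP[? ?]; case: (leP r 2^-1) => ?; [left|right]; lra.
  by case=> /andP[? ?]; lra.
have c2 (u v : R) : continuous (fun t : R => u * t + v).
  move=> t; apply: cvgD; last exact: cvg_cst.
  by apply: cvgM; [exact: cvg_cst|exact: cvg_id].
apply: withinU_continuous; [exact: interval_closed|exact: interval_closed| |].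
  apply: (@subspace_eq_continuous _ _ _ (fun t : R => (f \o clamp (R := R)) (2 * t + 0))).
    move=> t; rewrite inE /= in_itv /= => /andP[t0 t2].
    by rewrite /from_subspace /loop_concat t2 addr0 clamp_id//; apply/andP; split; lra.
  apply: continuous_subspaceT => t.
  by apply: (@continuous_comp _ _ _ (fun t : R => 2 * t + 0) (f \o clamp (R := R))); [exact: c2|exact: within_clamp].
apply: (@subspace_eq_continuous _ _ _ (fun t : R => (g \o clamp (R := R)) (2 * t + (-1)))).
  move=> t; rewrite inE /= in_itv /= => /andP[t0 t2].
  rewrite /from_subspace /loop_concat clamp_id; last by apply/andP; split; lra.
  case: leP => // t2'; have -> : t = 2^-1 by lra.
  by rewrite divff// subrr fg.
apply: continuous_subspaceT => t.
by apply: (@continuous_comp _ _ _ (fun t : R => 2 * t + (-1)) (g \o clamp (R := R))); [exact: c2|exact: within_clamp].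
Qed.

Lemma loop_concat0 f g : loop_concat f g 0 = f 0.
Proof. by rewrite /loop_concat mulr0 invr_ge0 ler0n. Qed.

Lemma loop_concat1 f g : loop_concat f g 1 = g 1.
Proof.
rewrite /loop_concat; case: leP => [h|_]; last by congr g; lra.
by exfalso; lra.
Qed.

Lemma is_loop_concat x f g : is_loop x f -> is_loop x g -> is_loop x (loop_concat f g).
Proof.
move=> [cf f0 f1] [cg g0 g1]; split; first by apply: loop_concat_continuous; rewrite ?f1.
  by rewrite loop_concat0.
by rewrite loop_concat1.
Qed.

Lemma is_loop_cst x : is_loop x (cst x : R -> T).
Proof. by split=> //; apply: continuous_subspaceT => t; exact: cvg_cst. Qed.

Lemma loop_homotopic_eq x (f f' : R -> T) : is_loop x f ->
  (forall t, 0 <= t <= 1 -> f t = f' t) -> loop_homotopic x f' f.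
Proof.
move=> [cf f0 f1] ff'; exists (fun st => (f \o clamp (R := R)) st.2); split.
- apply: continuous_subspaceT => st.
  apply: (@continuous_comp _ _ _ snd (f \o clamp (R := R))); first exact: cvg_snd.
  exact: within_clamp.
- by move=> t; rewrite in_itv /= => t01; rewrite clamp_id// ff'.
- by move=> t; rewrite in_itv /= => t01; rewrite clamp_id.
- by move=> s _ /=; rewrite !clamp_id ?lexx ?ler01.
Qed.

End Concatenation.

Section LoopLifts.
Variables (R : realType) (Y X : topologicalType) (p : Y -> X).
Hypothesis covp : is_covering p.

Lemma lifts_to_concat (f f' : R -> X) y y' y'' : lifts_to p f y y' -> lifts_to p f' y' y'' ->
  lifts_to p (loop_concat f f') y y''.
Proof.
move=> [g [cg g0 g1 pg]] [g' [cg' g'0 g'1 pg']]; exists (loop_concat g g'); split.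
- by apply: loop_concat_continuous; rewrite ?g1.
- by rewrite loop_concat0.
- by rewrite loop_concat1.
- move=> t /andP[t0 t1]; rewrite /loop_concat; case: leP => t2.
    by apply: pg; apply/andP; split; lra.
  by apply: pg'; apply/andP; split; lra.
Qed.

(** In the lifted homotopy the edge of final points lies over [x], so it is constant, and it starts
    at the end of the closed lift [g]. *)
Lemma homotopic_lifts_closed x (f f' : R -> X) y : loop_homotopic x f f' ->
  lifts_to p f y y -> lifts_to p f' y y.
Proof.
move=> [H [cH Hf Hf' Hx]] [g [cg g0 g1 pg]].
have in01 (t : R) : 0 <= t <= 1 -> t \in `[0, 1] by rewrite in_itv.
pose H' (st : R * R) := H (clamp st.1, clamp st.2).
have cH' : continuous H'.
  move=> st; have := cH; rewrite subspace_continuousP => /(_ (clamp st.1, clamp st.2)).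
  move=> /(_ (conj (clamp_itv _) (clamp_itv _))) cHst W /cHst Ws.
  have c2 : {for st, continuous (fun st : R * R => (clamp st.1, clamp st.2))}.
    apply: continuous_pair; apply: continuous_comp;
      [exact: cvg_fst|exact: clamp_continuous|exact: cvg_snd|exact: clamp_continuous].
  have := c2 _ Ws; apply: (@filterS _ (nbhs st)) => uv /=; apply.
  by split; exact: clamp_itv.
have px : p y = x.
  by rewrite -g0 pg ?lexx ?ler01// -Hf ?in01 ?lexx ?ler01//; apply: (Hx 0 _).1; rewrite in01 ?lexx ?ler01.
have [|z|K [cK K0 pK]] := homotopy_lifting covp (f := fun=> y) cH'.
- by move=> z; exact: cvg_cst.
- by rewrite /H' /= (clamp_id (t := 0)) ?lexx ?ler01// (Hx _ (clamp_itv _)).1.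
have cKs s : continuous (fun t => K (s, t)).
  move=> t; apply: (@continuous_comp _ _ _ (fun t => (s, t)) K); last exact: cK.
  by apply: continuous_pair; [exact: cvg_cst|exact: cvg_id].
have K1 : K (0, 1) = y.
  rewrite -g1; apply: (@lifts_agree R _ _ _ covp (fun t => K (0, t)) g 0);
    rewrite ?lexx ?ler01//.
  - exact: continuous_subspaceT.
  - move=> t t01; rewrite pK// pg// /H' /= !clamp_id ?lexx ?ler01//.
    by rewrite Hf ?in01.
  - by rewrite K0 g0.
have K11 : K (1, 1) = y.
  rewrite -[RHS]K1; apply: (@unique_lifting _ _ _ covp R (fun s => K (s, 1)) (fun=> K (0, 1)) 0).
  - exact: real_line_connected.
  - move=> s; apply: (@continuous_comp _ _ _ (fun s : R => (s, 1 : R)) K); last exact: cK.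
    by apply: continuous_pair; [exact: cvg_id|exact: cvg_cst].
  - by move=> s; exact: cvg_cst.
  - move=> s; rewrite !pK ?lexx ?ler01// /H' /= !(clamp_id (t := 1)) ?lexx ?ler01//.
    by rewrite !(Hx _ (clamp_itv _)).2.
  - by [].
exists (fun t => K (1, t)); split=> //; first exact: continuous_subspaceT.
move=> t t01; rewrite pK// /H' /= !clamp_id ?lexx ?ler01//.
by rewrite Hf' ?in01.
Qed.

End LoopLifts.

(** * Action of loops on the fibre over the base point *)

Section Monodromy.
Variables (R : realType) (G : finZmodType) (Y X : topologicalType) (p : Y -> X).
Variables (x0 : X) (kappa : (R -> X) -> G) (y0 : Y).
Hypothesis covp : is_covering p.
Hypothesis kappaP : pi1_morphism x0 kappa.
Hypothesis kappa_kernel : forall f : R -> X, is_loop x0 f -> (kappa f = 0 <->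
  exists2 g : R -> Y, is_loop y0 g & loop_homotopic x0 (p \o g) f).

Lemma kappa0_closed f : is_loop x0 f -> kappa f = 0 <-> lifts_to p f y0 y0.
Proof.
move=> loopf; rewrite kappa_kernel//; split.
  move=> [g [cg g0 g1] pgf]; apply: homotopic_lifts_closed pgf _ => //.
  by exists g.
move=> [g [cg g0 g1 pg]]; exists g; first by split.
by apply: loop_homotopic_eq => // t t01; rewrite /= pg.
Qed.

Lemma kappa_concat f f' : is_loop x0 f -> is_loop x0 f' ->
  kappa (loop_concat f f') = kappa f + kappa f'.
Proof. exact: (kappaP.2). Qed.

Lemma kappa_cst : kappa (cst x0) = 0.
Proof.
have := kappa_concat (is_loop_cst R x0) (is_loop_cst R x0).
have -> : loop_concat (cst x0) (cst x0) = cst x0 :> (R -> X).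
  by apply/funext => t; rewrite /loop_concat /=; case: ifP.
by move/eqP; rewrite -subr_eq0 opprD addrA subrr sub0r oppr_eq0 => /eqP.
Qed.

Lemma kappa_multiple f n : is_loop x0 f -> exists2 f', is_loop x0 f' & kappa f' = kappa f *+ n.
Proof.
move=> loopf; elim: n => [|n [f' loopf' IH]].
  by exists (cst x0); [exact: is_loop_cst|rewrite kappa_cst].
by exists (loop_concat f f'); [exact: is_loop_concat|rewrite kappa_concat// IH mulrS].
Qed.

Lemma finZmod_mulrn_card (g : G) : g *+ #|G| = 0.
Proof.
have := reindex_inj (addIr g) (P := xpredT) (F := id) (op := +%R) (x := 0).
rewrite big_split sumr_const /= => /eqP.
by rewrite -subr_eq0 opprD addrA subrr sub0r oppr_eq0 => /eqP.
Qed.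

(** In a finite group the opposite is the (|G| - 1)-fold multiple, so repeating the loop replaces
    reversing it. *)
Lemma kappa_opp f : is_loop x0 f -> exists2 f', is_loop x0 f' & kappa f' = - kappa f.
Proof.
move=> loopf; have [f' loopf' kf'] := kappa_multiple (#|G|.-1) loopf.
exists f' => //; apply/eqP; rewrite -addr_eq0 kf' -mulrSr prednK ?finZmod_mulrn_card//.
by apply/card_gt0P; exists 0.
Qed.

(** Append a loop [k] with value [- kappa f']: the composite has value 0 iff it lifts to a closed
    path, that is, iff [k] leads from the end of the first lift back to [y0]. *)
Lemma lifts_to_kappa f f' y y' : is_loop x0 f -> is_loop x0 f' ->
  lifts_to p f y0 y -> lifts_to p f' y0 y' -> (y = y' <-> kappa f = kappa f').
Proof.
move=> loopf loopf' fy f'y'.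
have [k loopk kE] := kappa_opp loopf'.
have closed f1 y1 : is_loop x0 f1 -> lifts_to p f1 y0 y1 ->
    (kappa f1 = kappa f' <-> lifts_to p k y1 y0).
  move=> loop1 fy1; have loop1k := is_loop_concat loop1 loopk.
  transitivity (kappa (loop_concat f1 k) = 0).
    by rewrite kappa_concat// kE; split=> [->|/eqP]; rewrite ?subrr// subr_eq0 => /eqP.
  rewrite kappa0_closed//; split=> [|ky1]; last exact: lifts_to_concat fy1 ky1.
  have [y2 ky2] : exists y2, lifts_to p k y1 y2.
    have [ck k0 _] := loopk; apply: lifts_to_exists => //.
    by rewrite (lifts_to_fiber fy1).2; case: loop1 => _ _ ->.
  by move=> /(lifts_to_unique covp (lifts_to_concat fy1 ky2)) <-.
have ky' := (closed _ _ loopf' f'y').1 erefl.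
split=> [yy'|/(closed _ _ loopf fy) ky]; first by apply/(closed _ _ loopf fy); rewrite yy'.
exact: lifts_to_inj ky ky'.
Qed.

Lemma kappa_onto (S : set G) : <<[set g : G | `[< S g >]]%SET>>%g = [set: G]%SET ->
  (forall g, S g -> exists2 f, is_loop x0 f & kappa f = g) ->
  forall g, exists2 f, is_loop x0 f & kappa f = g.
Proof.
move=> Sgen SV.
pose V := [set g : G | `[< exists2 f, is_loop x0 f & kappa f = g >]]%SET.
have VG : group_set V.
  apply/group_setP; split.
    by rewrite inE; apply/asboolP; exists (cst x0); [exact: is_loop_cst|rewrite kappa_cst].
  move=> g g'; rewrite !inE => -[f loopf <-] [f' loopf' <-].
  exists (loop_concat f f'); first exact: is_loop_concat.
  by rewrite kappa_concat// FinRing.zmodMgE.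
have : ([set: G] \subset Group VG)%SET.
  rewrite -Sgen gen_subG; apply/fintype.subsetP => g; rewrite !inE => Sg.
  exact: SV.
by move=> /fintype.subsetP SVG g; have := SVG g; rewrite !inE => /(_ isT).
Qed.

End Monodromy.

(** * Lifts of the polygon to a cover of the surface *)

Section Sections.
Variables (R : realType) (Y : topologicalType) (p : Y -> chamanara R).
Hypothesis covp : is_covering p.

Definition center : @polygon R := to_polygon (midpoint R).

Lemma midpoint_open_square : @open_square R (midpoint R).
Proof. by split; apply/andP; split=> /=; lra. Qed.

Lemma midpoint_polygon : @polygon R (midpoint R).
Proof. by left; exact: midpoint_open_square. Qed.

Lemma surface_center : surface center = base_point R.
Proof. by []. Qed.

Lemma polygon_connected : connected [set: @polygon R].
Proof.
have -> : [set: @polygon R] = set_val @^-1` [set: R * R] by [].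
by apply: convex_polygon_connected midpoint_open_square _.
Qed.

Definition is_section (sigma : @polygon R -> Y) : Prop :=
  continuous sigma /\ forall x, p (sigma x) = surface x.

Lemma section_unique sigma tau x : is_section sigma -> is_section tau ->
  sigma x = tau x -> sigma =1 tau.
Proof.
move=> [cs ps] [ct pt]; apply: (unique_lifting covp polygon_connected cs ct).
by move=> z; rewrite ps pt.
Qed.

Definition spoke (x : @polygon R) (t : R) : @polygon R :=
  to_polygon (ray (midpoint R) (set_val x) (clamp t)).

Lemma spoke_continuous (T : topologicalType) (f : T -> @polygon R) (g : T -> R) :
  continuous f -> continuous g -> continuous (fun z => spoke (f z) (g z)).
Proof.
move=> cf cg; apply: to_polygon_continuous.
  move=> z; apply: (@continuous_comp _ _ _ (fun z => (set_val (f z), clamp (g z)))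
    (fun xt => ray (midpoint R) xt.1 xt.2)); last exact: ray_continuous.
  apply: continuous_pair.
    by apply: (@continuous_comp _ _ _ f set_val); [exact: cf|exact: polygon_val_continuous].
  by apply: (@continuous_comp _ _ _ g (@clamp R)); [exact: cg|exact: clamp_continuous].
move=> z; apply: ray_polygon; [exact: midpoint_open_square|exact: polygon_val|exact: clamp01].
Qed.

Lemma spoke0 x : spoke x 0 = center.
Proof. by rewrite /spoke clamp_id ?lexx ?ler01// ray0. Qed.

Lemma spoke1 x : spoke x 1 = x.
Proof. by rewrite /spoke clamp_id ?lexx ?ler01// ray1 to_polygon_val. Qed.

(* The polygon is star-shaped around its center: lift the homotopy that
   contracts it along the rays. *)
Lemma section_exists y : p y = base_point R -> exists2 sigma, is_section sigma & sigma center = y.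
Proof.
move=> py.
pose H (xt : @polygon R * R) := surface (spoke xt.1 xt.2).
have cH : continuous H.
  move=> xt; apply: (@continuous_comp _ _ _ (fun xt : @polygon R * R => spoke xt.1 xt.2) (@surface R)).
    by apply: spoke_continuous => z; [exact: cvg_fst|exact: cvg_snd].
  exact: surface_continuous.
have [|x|K [cK K0 pK]] := homotopy_lifting covp (f := fun=> y) cH.
- exact: cst_continuous.
- by rewrite /H /= spoke0 surface_center.
exists (fun x => K (x, 1)); first split.
- move=> x; apply: (@continuous_comp _ _ _ (fun x => (x, 1 : R)) K); last exact: cK.
  by apply: continuous_pair; [exact: cvg_id|exact: cst_continuous].
- by move=> x; rewrite pK ?lexx ?ler01// /H /= spoke1.
rewrite -(K0 center).
have cKc : continuous (fun t => K (center, t)).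
  move=> t; apply: (@continuous_comp _ _ _ (fun t => (center, t)) K); last exact: cK.
  by apply: continuous_pair; [exact: cvg_cst|exact: cvg_id].
apply: (@lifts_agree R _ _ p covp (fun t => K (center, t)) (fun=> K (center, 0)) 0);
  rewrite ?lexx ?ler01//.
- exact: continuous_subspaceT.
- by apply: continuous_subspaceT => t; exact: cvg_cst.
- move=> t t01; rewrite !pK ?lexx ?ler01// /H /= spoke0 /spoke to_polygonK; last exact: midpoint_polygon.
  by rewrite /ray subrr scaler0 addr0.
Qed.

(** Lift the spoke from [x] back to the center, starting at [y], and take the section through its
    end; unique lifting along the spoke brings it back to [y]. *)
Lemma section_through y x : surface x = p y -> exists2 sigma, is_section sigma & sigma x = y.
Proof.
move=> xy.
have c1 : continuous (fun t : R => 1 - t).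
  by move=> t; apply: cvgB; [exact: cvg_cst|exact: cvg_id].
have cs (f : R -> R) : continuous f -> continuous (fun t => surface (spoke x (f t))).
  move=> cf t; apply: (@continuous_comp _ _ _ (fun t => spoke x (f t)) (@surface R)).
    by apply: spoke_continuous; [move=> z; exact: cvg_cst|exact: cf].
  exact: surface_continuous.
have [|g [cg g0 pg]] := path_lifting covp (cs _ c1) (y := y).
  by rewrite subr0 spoke1.
have [|sigma [csig psig] sigc] := @section_exists (g 1).
  by rewrite pg ?lexx ?ler01// subrr spoke0.
exists sigma; first by split.
have csp : continuous (fun t : R => sigma (spoke x (1 - t))).
  move=> t; apply: (@continuous_comp _ _ _ (fun t : R => spoke x (1 - t)) sigma).
    by apply: spoke_continuous; [move=> z; exact: cvg_cst|exact: c1].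
  exact: csig.
have := @lifts_agree R _ _ p covp (fun t : R => sigma (spoke x (1 - t))) g 1.
move=> /(_ (continuous_subspaceT csp) (continuous_subspaceT cg)) agree.
rewrite -g0 -(agree _ _ _ 0) ?subr0 ?spoke1 ?lexx ?ler01//.
- by move=> t t01; rewrite psig pg.
- by rewrite subrr spoke0.
Qed.

(** On an evenly covered set, every section that meets a given sheet coincides nearby with the local
    inverse of [p], so openness can be tested on the quotient from the polygon. *)
Lemma section_open W : (forall sigma, is_section sigma -> open (sigma @^-1` W)) -> open W.
Proof.
move=> oW; rewrite openE => y Wy.
have [U [oU Uy chart]] := covering_chart covp (p y).
have [V [s [[oV Vy] VU cs sp Vs]]] := chart y Uy.
pose B := [set u | U u /\ W (s u)].
have oB : open B.
  apply: surface_open; rewrite openE => x [Ux Wx].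
  have [sigma [csig psig] sigx] : exists2 sigma, is_section sigma & sigma x = s (surface x).
    by apply: section_through; rewrite (Vs _ Ux).2.
  have VWx : nbhs x (sigma @^-1` V `&` sigma @^-1` W).
    apply: filterI; last by apply: open_nbhs_nbhs; split; [exact: oW|rewrite /= sigx].
    by apply: csig; apply: open_nbhs_nbhs; split=> //; rewrite sigx; exact: (Vs _ Ux).1.
  apply: filterS VWx => z [Vz Wz]; split; first by rewrite -psig; exact: VU.
  by rewrite -psig sp.
have nB : nbhs y (V `&` p @^-1` B).
  apply: filterI; first by apply: open_nbhs_nbhs.
  have [cp _ _] := covp; apply: cp; apply: open_nbhs_nbhs; split=> //.
  by split=> //; rewrite sp.
by apply: filterS nB => v [Vv [_]]; rewrite sp.
Qed.

Definition outward x : R -> chamanara R := fun t => surface (spoke x t).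
Definition inward x : R -> chamanara R := fun t => surface (spoke x (1 - t)).

Lemma spoke_path (T : topologicalType) (f : @polygon R -> T) x : continuous f ->
  {within `[0, 1], continuous (fun t : R => f (spoke x t))} /\
  {within `[0, 1], continuous (fun t : R => f (spoke x (1 - t)))}.
Proof.
move=> cf; split; apply: continuous_subspaceT => t.
  apply: (@continuous_comp _ _ _ (fun t : R => spoke x t) f); last exact: cf.
  by apply: spoke_continuous => z; [exact: cvg_cst|exact: cvg_id].
apply: (@continuous_comp _ _ _ (fun t : R => spoke x (1 - t)) f); last exact: cf.
apply: spoke_continuous => z; first exact: cvg_cst.
by apply: cvgB; [exact: cvg_cst|exact: cvg_id].
Qed.

Lemma crossingE q q' t : @polygon R q -> @polygon R q' -> 0 <= t <= 1 ->
  loop_concat (outward (to_polygon q)) (inward (to_polygon q')) t = crossing q q' t.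
Proof.
move=> Pq Pq' /andP[t0 t1]; rewrite /loop_concat /crossing /outward /inward /spoke.
case: leP => t2; rewrite surface_pointE to_polygonK// clamp_id//; last first.
- by apply/andP; split; lra.
- congr (surface (to_polygon _)); rewrite /ray /midpoint; case: q' {Pq'} => a b.
  by congr pair => /=; rewrite /GRing.scale /=; ring.
- by apply/andP; split; lra.
Qed.

Lemma crossing_loop q q' : @polygon R q -> @polygon R q' ->
  surface (to_polygon q) = surface (to_polygon q') ->
  is_loop (base_point R) (crossing q q').
Proof.
move=> Pq Pq' qq'; have cE t := @crossingE q q' t Pq Pq'.
split; last 2 first.
- by rewrite -cE ?lexx ?ler01// loop_concat0 /outward spoke0.
- by rewrite -cE ?lexx ?ler01// loop_concat1 /inward subrr spoke0.
apply: (@subspace_eq_continuous _ _ _ (loop_concat (outward (to_polygon q)) (inward (to_polygon q')))).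
  by move=> t; rewrite inE /= in_itv /= => t01; rewrite /from_subspace cE.
apply: loop_concat_continuous.
- exact: (spoke_path _ (@surface_continuous R)).1.
- exact: (spoke_path _ (@surface_continuous R)).2.
- by rewrite /outward /inward subr0 !spoke1.
Qed.

(** The outward half of the lift follows [sigma]; the inward half, traced back from its end [y'],
    follows [sigma']. *)
Lemma crossing_lift q q' y y' sigma sigma' : @polygon R q -> @polygon R q' ->
  surface (to_polygon q) = surface (to_polygon q') ->
  lifts_to p (crossing q q') y y' -> is_section sigma -> is_section sigma' ->
  sigma center = y -> sigma' center = y' ->
  sigma (to_polygon q) = sigma' (to_polygon q').
Proof.
move=> Pq Pq' qq' cyy' [cs ps] [cs' ps'] sy s'y'.
have outq : lifts_to p (outward (to_polygon q)) y (sigma (to_polygon q)).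
  exists (fun t => sigma (spoke (to_polygon q) t)); split=> //.
  - exact: (spoke_path _ cs).1.
  - by rewrite spoke0.
  - by rewrite spoke1.
have inq' : lifts_to p (inward (to_polygon q')) (sigma' (to_polygon q')) y'.
  exists (fun t => sigma' (spoke (to_polygon q') (1 - t))); split=> //.
  - exact: (spoke_path _ cs').2.
  - by rewrite subr0 spoke1.
  - by rewrite subrr spoke0.
have [y2 inqy2] : exists y2, lifts_to p (inward (to_polygon q')) (sigma (to_polygon q)) y2.
  apply: lifts_to_exists => //; first exact: (spoke_path _ (@surface_continuous R)).2.
  by rewrite ps /inward subr0 spoke1.
have := lifts_to_concat outq inqy2.
move/(lifts_to_eq (fun t => @crossingE q q' t Pq Pq'))/(lifts_to_unique covp cyy') => y'y2.
by apply: (lifts_to_inj covp) inqy2 _; rewrite -y'y2.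
Qed.

End Sections.

Lemma side_point_continuous (R : realType) s e n :
  continuous (side_point s e n : R -> R * R).
Proof.
pose f (t : R) := if e then 2 ^- n.+1 + t else 1 - 2 ^- n + t.
have cf : continuous f.
  by rewrite /f => t; case: (e); apply: cvgD; (exact: cvg_cst || exact: cvg_id).
move=> t; rewrite /side_point -/(f _) /coord; case: s.
  apply: (@continuous_pair R R R f (fun=> side_pos R e)); first exact: cf.
  exact: cvg_cst.
by apply: (@continuous_pair R R R (fun=> side_pos R e) f); [exact: cvg_cst|exact: cf].
Qed.

Section VectorCover.
Variables (R : realType) (G : finZmodType) (h : int -> G) (Y : topologicalType).
Variable p : Y -> chamanara R.
Hypothesis hP : defining_vector h.
Hypothesis coverp : is_cover_of_vector h p.

Let covp : is_covering p. Proof. by case: coverp => -[[]]. Qed.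
Let Y_connected : connected [set: Y]. Proof. by case: coverp => -[[]]. Qed.

Lemma side_middle s e n : side_point s e n (2 ^- n.+2 : R) =
  coord s (side_pos R e) (if e then 3 * 2 ^- n.+2 else 1 - 3 * 2 ^- n.+2).
Proof.
rewrite /side_point (halfS R n) (halfS R n.+1); case: e; congr coord; ring.
Qed.

Lemma side_range_middle n : side_range n (2 ^- n.+2 : R).
Proof.
by rewrite /side_range (halfS R n.+1); have := half_gt0 R n.+2; move=> ?; apply/andP; split; lra.
Qed.

(** The fibre over the base point is indexed by the values of [kappa] on loops lifted from [y0]; the
    copy [g] of the polygon is its lift centered at the point of index [g]. *)
Lemma vector_cover_atlas : exists Phi : G -> @polygon R -> Y, labelled_atlas h Phi.
Proof.
have [[_ _] [kappa [kappaP kappa_seg] [y0 py0 kappa_ker]]] := coverp.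
have [hgen h0] := hP.
(* Covers both families: [alpha] leaves through the high side and [beta] through the low one. *)
have cross s n : is_loop (base_point R) (crossing (side_point s (~~ s) n (2 ^- n.+2 : R)) (side_point s s n (2 ^- n.+2))).
  have Pn e := side_point_polygon s e (side_range_middle n).
  apply: crossing_loop => //.
  by have := surface_side s (side_range_middle n); case: s {Pn} => [->|->].
have kcross s n : kappa (crossing (side_point s (~~ s) n (2 ^- n.+2 : R)) (side_point s s n (2 ^- n.+2))) =
    h (if s then - n.+1%:Z else n.+1%:Z).
  have [ka kb] := kappa_seg n.+1 isT.
  by rewrite !side_middle; case: s; [exact: kb|exact: ka].
have konto g : exists2 f, is_loop (base_point R) f & kappa f = g.
  apply: (kappa_onto kappaP (S := [set g | exists i, h i = g])) g => //.
  move=> _ [[[|n]|n] <-].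
  - by exists (cst (base_point R)); [exact: is_loop_cst|rewrite h0; exact: kappa_cst].
  - by eexists; [exact: (cross false n)|rewrite kcross].
  - by eexists; [exact: (cross true n)|rewrite kcross NegzE].
have eP g : exists y, exists f, [/\ is_loop (base_point R) f, kappa f = g & lifts_to p f y0 y].
  have [f loopf kf] := konto g; have [cf f0 f1] := loopf.
  by have [y fy] := lifts_to_exists covp cf (etrans py0 (esym f0)); exists y, f.
have [e eE] := choice eP.
have kappa_lift f g y : is_loop (base_point R) f -> lifts_to p f y0 y -> kappa f = g -> y = e g.
  move=> loopf fy kf; have [f' [loopf' kf' f'y]] := eE g.
  by apply/(lifts_to_kappa covp kappaP kappa_ker loopf loopf' fy f'y); rewrite kf.
have e_inj : injective e.
  move=> g g' gg'; have [f [loopf kf fg]] := eE g; have [f' [loopf' kf' f'g]] := eE g'.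
  by rewrite -kf -kf'; apply/(lifts_to_kappa covp kappaP kappa_ker loopf loopf' fg f'g).
have e_step g f : is_loop (base_point R) f -> lifts_to p f (e g) (e (g + kappa f)).
  move=> loopf; have [f1 [loop1 k1 f1g]] := eE g; have [cf f0 _] := loopf.
  have [|y fy] := lifts_to_exists covp cf (y := e g).
    by rewrite (lifts_to_fiber f1g).2; case: loop1 => _ _ ->.
  rewrite -(kappa_lift (loop_concat f1 f) (g + kappa f) y) //.
  - exact: is_loop_concat.
  - exact: lifts_to_concat f1g fy.
  - by rewrite (kappa_concat kappaP)// k1.
have secP g : exists s, is_section p s /\ s (center R) = e g.
  have [f [loopf _ fg]] := eE g.
  have [|s sP sg] := section_exists covp (y := e g); last by exists s.
  by rewrite (lifts_to_fiber fg).2; case: loopf.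
have [Phi PhiP] := choice secP.
exists Phi.
have Phi_sec g : is_section p (Phi g) by have [] := PhiP g.
have Phi_c g : Phi g (center R) = e g by have [] := PhiP g.
have pPhi g x : p (Phi g x) = surface x by have [_] := Phi_sec g; apply.
have Phi_inj g g' x : Phi g x = Phi g' x -> g = g'.
  by move=> /(section_unique covp (Phi_sec g) (Phi_sec g'))/(_ (center R)); rewrite !Phi_c => /e_inj.
have Phi_glue g s n t : side_range n t ->
    Phi g (to_polygon (side_point s true n t)) =
    Phi (g + label h s n) (to_polygon (side_point s false n t)).
  move=> nt; have nm := side_range_middle n.
  have Pn e1 := side_point_polygon s e1 nm.
  have glue_mid : Phi g (to_polygon (side_point s true n (2 ^- n.+2))) =
      Phi (g + label h s n) (to_polygon (side_point s false n (2 ^- n.+2))).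
    have sm := surface_side s nm.
    case: s nt Pn sm => nt Pn sm.
      apply/esym; apply: (crossing_lift covp (Pn false) (Pn true) sm _
        (Phi_sec _) (Phi_sec _) (Phi_c _) (Phi_c _)).
      have := e_step (g + label h true n) _ (cross true n).
      by rewrite kcross /label addrNK.
    apply: (crossing_lift covp (Pn true) (Pn false) (esym sm) _
      (Phi_sec _) (Phi_sec _) (Phi_c _) (Phi_c _)).
    by have := e_step g _ (cross false n); rewrite kcross.
  (* Slides from the middle of the segment, where the loops cross it, to [t]; both copies lift the
     same path in the surface. *)
  pose u (r : R) := 2 ^- n.+2 + clamp r * (t - 2 ^- n.+2).
  have un r : side_range n (u r) by apply: segment_between; [exact: clamp01|exact: nm|exact: nt].
  have cu : continuous u.
    move=> r; apply: cvgD; first exact: cvg_cst.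
    by apply: cvgM; [exact: clamp_continuous|exact: cvg_cst].
  have cside e1 g1 : continuous (fun r => Phi g1 (to_polygon (side_point s e1 n (u r)))).
    move=> r; apply: (@continuous_comp _ _ _ (fun r => to_polygon (side_point s e1 n (u r))) (Phi g1)).
      apply: to_polygon_continuous; last by move=> z; exact: side_point_polygon.
      move=> z; apply: (@continuous_comp _ _ _ u (side_point s e1 n)); first exact: cu.
      exact: side_point_continuous.
    exact: (Phi_sec g1).1.
  have u1 : u 1 = t by rewrite /u clamp_id ?lexx ?ler01// mul1r addrC subrK.
  have u0 : u 0 = 2 ^- n.+2 by rewrite /u clamp_id ?lexx ?ler01// mul0r addr0.
  rewrite -u1; apply: (unique_lifting covp (@real_line_connected R) (cside true g) (cside false _) (z0 := 0)).
    by move=> r; rewrite !pPhi (surface_side s (un r)).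
  by rewrite u0.
have Phi_sep g g' x x' : Phi g x = Phi g' x' ->
    (x = x' /\ g = g') \/ exists s e1 n t, [/\ side_range n t,
      set_val x = side_point s e1 n t, set_val x' = side_point s (~~ e1) n t &
      g' = g + shift e1 (label h s n)].
  move=> xx'; have : surface x = surface x' by rewrite -(pPhi g x) xx' pPhi.
  have valE (z : @polygon R) z' : set_val z = z' -> z = to_polygon z' by move=> <-; rewrite to_polygon_val.
  move=> /surfaceP[xE|/gluedP[s [n [t [nt xE x'E]]]]|/gluedP[s [n [t [nt x'E xE]]]]].
  - by left; split=> //; apply: (Phi_inj g g' x); rewrite xx' xE.
  - right; exists s, false, n, t; split=> //=; apply/esym.
    apply: (Phi_inj _ _ x'); rewrite -xx' (valE _ _ xE) (valE _ _ x'E) Phi_glue//.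
    by rewrite subrK.
  - right; exists s, true, n, t; split=> //=; apply/esym.
    by apply: (Phi_inj _ _ x'); rewrite -xx' (valE _ _ xE) (valE _ _ x'E) Phi_glue.
have sec_Phi sigma x g x' : is_section p sigma -> sigma x = Phi g x' ->
    exists g', sigma =1 Phi g'.
  move=> sigP sx; suff [g' xg'] : exists g', sigma x = Phi g' x.
    by exists g'; exact: section_unique sigP (Phi_sec g') xg'.
  have : surface x = surface x' by rewrite -(pPhi g x') -sx sigP.2.
  have valE (z : @polygon R) z' : set_val z = z' -> z = to_polygon z' by move=> <-; rewrite to_polygon_val.
  move=> /surfaceP[xx'|/gluedP[s [n [t [nt xE x'E]]]]|/gluedP[s [n [t [nt x'E xE]]]]].
  - by exists g; rewrite sx xx'.
  - by exists (g + label h s n); rewrite sx (valE _ _ xE) (valE _ _ x'E) Phi_glue.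
  - exists (g - label h s n); rewrite sx (valE _ _ xE) (valE _ _ x'E) Phi_glue//.
    by rewrite subrK.
(* A section that meets the image lies in it entirely, so the image and its complement are open by
   [section_open]. *)
have Phi_onto y : exists g x, Phi g x = y.
  pose A := [set y | exists g x, Phi g x = y].
  suff AT : A = setT by have : A y by rewrite AT.
  have sec_A sigma x : is_section p sigma -> A (sigma x) -> forall z, A (sigma z).
    move=> sigP [g [x' /esym xx']] z; have [g' ->] := sec_Phi _ _ _ _ sigP xx'.
    by exists g', z.
  apply: Y_connected.
  - by exists (Phi 0 (center R)), 0, (center R).
  - exists A; rewrite ?setTI//; apply: (section_open covp) => sigma sigP.
    rewrite openE => x Ax; apply: filterS filterT => z _; exact: sec_A Ax _.
  - exists A; rewrite ?setTI// -openC; apply: (section_open covp) => sigma sigP.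
    rewrite openE => x nAx; apply: filterS filterT => z _ Az; apply: nAx.
    exact: sec_A Az _.
split=> //; first by move=> g; exact: (Phi_sec g).1.
move=> W oW; apply: (section_open covp) => sigma sigP.
have [g [x gx]] := Phi_onto (sigma (center R)).
have [g' sg'] := sec_Phi _ _ _ _ sigP (esym gx).
by rewrite (_ : sigma = Phi g'); [exact: oW|exact/funext].
Qed.

End VectorCover.

(** * A model of the labelled cover *)

(* The copy [g] of the polygon is embedded by [sheet g] below, which cuts it open
   along its low sides. *)
Definition labelled_model (R : realType) (G : finZmodType) (h : int -> G) : Type :=
  (G * chamanara R)%type.

Section Model.
Variables (R : realType) (G : finZmodType) (h : int -> G).
Local Notation Y := (labelled_model R h).
Implicit Types (x : @polygon R) (g : G).

(* [xget] returns the default [0] away from the low sides. *)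
Definition cut x : G := xget 0 [set c | exists s n t,
  [/\ side_range n t, set_val x = side_point s false n t & c = label h s n]].

Lemma cut_low x s n t : side_range n t -> set_val x = side_point s false n t ->
  cut x = label h s n.
Proof.
move=> nt xE; apply: xget_unique; first by exists s, n, t.
move=> _ [s' [n' [t' [nt' xE' ->]]]].
by have [-> _ -> _] := side_point_inj nt nt' (etrans (esym xE) xE').
Qed.

Lemma cut_high x s n t : side_range n t -> set_val x = side_point s true n t ->
  cut x = 0.
Proof.
move=> nt xE; apply: xgetPN => c [s' [n' [t' [nt' xE' _]]]].
by have [] := side_point_inj nt nt' (etrans (esym xE) xE').
Qed.

Lemma cut_interior x : open_square (set_val x) -> cut x = 0.
Proof.
move=> ox; apply: xgetPN => c [s [n [t [nt xE _]]]].
by apply: (@side_point_not_open R s false n t); rewrite -xE.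
Qed.

(** The high side of copy [g] and the low side of copy [g + label h s n] both receive first
    coordinate [g]. *)
Definition sheet g x : Y := (g - cut x, surface x).

(** The final topology for the sheets; the product with a discrete [G] would give the trivial
    cover. *)
Definition model_open (W : set Y) : Prop := forall g, open (sheet g @^-1` W).

Lemma model_openT : model_open setT.
Proof. by move=> g; rewrite preimage_setT; exact: openT. Qed.

Lemma model_openI (W W' : set Y) : model_open W -> model_open W' -> model_open (W `&` W').
Proof. by move=> oW oW' g; rewrite preimage_setI; exact: openI. Qed.

Lemma model_open_bigU (I : Type) (W : I -> set Y) : (forall i, model_open (W i)) ->
  model_open (\bigcup_i W i).
Proof. by move=> oW g; rewrite preimage_bigcup; apply: bigcup_open => i _; exact: oW. Qed.

HB.instance Definition _ := Choice.on Y.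
HB.instance Definition _ := isOpenTopological.Build Y model_openT model_openI model_open_bigU.

Lemma model_openP (W : set Y) : open W <-> forall g, open (sheet g @^-1` W).
Proof. by []. Qed.

Definition model_proj (y : Y) : chamanara R := y.2.

Lemma sheet_continuous g : continuous (sheet g : @polygon R -> Y).
Proof. by apply/continuousP => W; apply. Qed.

Lemma model_atlas : labelled_atlas h (sheet : G -> @polygon R -> Y).
Proof.
split.
- exact: sheet_continuous.
- move=> [g y]; have [x <-] := surface_onto y.
  by exists (g + cut x), x; rewrite /sheet addrK.
- by [].
- move=> g s n t nt; rewrite /sheet (surface_side s nt).
  rewrite (@cut_high _ s n t) ?to_polygonK//; last exact: side_point_polygon.
  rewrite (@cut_low _ s n t) ?to_polygonK//; last exact: side_point_polygon.
  by rewrite subr0 addrK.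
- move=> g g' x x' [gg' /surfaceP[xx'|/gluedP[s [n [t [nt xE x'E]]]]|/gluedP[s [n [t [nt x'E xE]]]]]].
  + by left; split=> //; move: gg'; rewrite xx' => /addIr.
  + right; exists s, false, n, t; split=> //=.
    by move: gg'; rewrite (cut_low nt xE) (cut_high nt x'E) subr0.
  + right; exists s, true, n, t; split=> //=.
    by move: gg'; rewrite (cut_low nt x'E) (cut_high nt xE) subr0 => ->; rewrite subrK.
Qed.

Lemma model_proj_continuous : continuous model_proj.
Proof.
apply/continuousP => U oU; apply/model_openP => g.
by move/continuousP: (@surface_continuous R) => /(_ _ oU).
Qed.

Let subr_eq_swap (g c a b : G) : g - c = a + b <-> c + b = g - a.
Proof.
split=> [/eqP|/esym/eqP]; rewrite subr_eq => /eqP ->.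
  by rewrite (ACl ((1*4)*(3*2))%AC) /= subrr add0r.
by rewrite (ACl ((1*4)*(3*2))%AC) /= subrr add0r.
Qed.

(** The sheets over [U] are the graphs of the functions [a + s u]. They are open because [s]
    compensates the jumps of [cut], making the sum locally constant on the polygon. *)
Lemma model_evenly_covered (U : set (chamanara R)) (s : chamanara R -> G) : open U ->
  (forall v, open [set x : @polygon R | U (surface x) /\ cut x + s (surface x) = v]) ->
  evenly_covered model_proj U.
Proof.
move=> oU os; pose V a : set Y := [set y | U y.2 /\ y.1 = a + s y.2].
exists (range V); split.
- apply/seteqP; split=> [y Uy|y [_ [a _ <-] [Uy _]]] //.
  by exists (V (y.1 - s y.2)); [exists (y.1 - s y.2)|split=> //; rewrite subrK].
- move=> _ _ [a _ <-] [b _ <-] [y [[_ ya] [_ yb]]].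
  by congr V; apply: (@addIr _ (s y.2)); rewrite -ya.
- move=> _ [a _ <-]; apply/model_openP => g; have := os (g - a); congr open.
  by apply/seteqP; split=> x [Ux e]; split=> //=; apply/subr_eq_swap.
- move=> _ [a _ <-]; exists (fun u => (a + s u, u) : Y); split=> //.
  + by move=> y [].
  + rewrite continuous_open_subspace//; apply/continuous_inP => // W oW.
    apply: surface_open.
    have -> : @surface R @^-1` (U `&` (fun u => (a + s u, u) : Y) @^-1` W) =
        \bigcup_v ([set x : @polygon R | U (surface x) /\ cut x + s (surface x) = v] `&`
                   sheet (a + v) @^-1` W).
      have sE x : sheet (a + (cut x + s (surface x))) x = (a + s (surface x), surface x).
        by rewrite /sheet; congr pair; rewrite addrCA addrAC subrr add0r.
      apply/seteqP; split=> [x [Ux Wx]|x [v _ [[Ux <-] Wx]]].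
        by exists (cut x + s (surface x)) => //; split=> //=; rewrite sE.
      by split=> //=; rewrite -sE.
    by apply: bigcup_open => v _; apply: openI; [exact: os|exact: oW].
  + by move=> [g u] [/= _ ->].
Qed.

Lemma surface_interior x x' : open_square (set_val x') -> surface x = surface x' -> x = x'.
Proof.
move=> ox /surfaceP[//|/gluedP[s [n [t [nt _ xE]]]]|/gluedP[s [n [t [nt xE _]]]]];
  by exfalso; move: ox; rewrite xE; exact: side_point_not_open.
Qed.

Lemma interior_open : open [set x : @polygon R | open_square (set_val x)].
Proof.
apply: (@preimage_open R (@open_square R)).
have -> : @open_square R = fst @^-1` `]0, 1[%classic `&` snd @^-1` `]0, 1[%classic.
  by apply/seteqP; split=> p; rewrite /open_square /= !in_itv.
by apply: openI; apply: open_comp => [p _|]; [exact: cvg_fst|exact: interval_open|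
  exact: cvg_snd|exact: interval_open].
Qed.

Lemma interior_even x : open_square (set_val x) ->
  exists U, [/\ open U, U (surface x) & evenly_covered model_proj U].
Proof.
move=> ox; pose I := [set z : @polygon R | open_square (set_val z)].
have IE : @surface R @^-1` (@surface R @` I) = I.
  by apply/seteqP; split=> z Iz; [case: Iz => z' Iz' /esym/surface_interior -> //|exists z].
have oU : open (@surface R @` I) by apply: surface_open; rewrite IE; exact: interior_open.
exists (@surface R @` I); split; [exact: oU|by exists x|].
apply: (@model_evenly_covered _ (fun=> 0)) => // v.
have [<-|v0] := eqVneq 0 v.
  have -> : [set z : @polygon R | (@surface R @` I) (surface z) /\ cut z + 0 = 0] = I.
    have IP z : (@surface R @` I) (surface z) <-> I z by rewrite -[X in _ <-> X z]IE.
    by apply/seteqP; split=> z; [move=> [/IP]|move=> Iz; split; [exact/IP|rewrite cut_interior ?addr0]].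
  exact: interior_open.
have -> : [set z : @polygon R | (@surface R @` I) (surface z) /\ cut z + 0 = v] = set0; last exact: open0.
rewrite -subset0 => z [[z' Iz' /esym/surface_interior -> //]].
by rewrite cut_interior// addr0 => /eqP; rewrite (negbTE v0).
Qed.

Definition normal s (p : R * R) : R := if s then p.2 else p.1.
Definition tangent s (p : R * R) : R := if s then p.1 else p.2.

(** Reaches from one segment to the middle line of the square, so that it meets no other segment and
    is disjoint from the strip of the partner. *)
Definition strip s e n : set (@polygon R) := [set x |
  (if e then 2^-1 < normal s (set_val x) else normal s (set_val x) < 2^-1) /\
  if e then 2 ^- n.+1 < tangent s (set_val x) < 2 ^- n
  else 1 - 2 ^- n < tangent s (set_val x) < 1 - 2 ^- n.+1].

Lemma strip_open s e n : open (strip s e n).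
Proof.
have cn : continuous (normal s) by case: (s) => p; [exact: cvg_snd|exact: cvg_fst].
have ct : continuous (tangent s) by case: (s) => p; [exact: cvg_fst|exact: cvg_snd].
pose A : set R := if e then [set a | 2^-1 < a] else [set a | a < 2^-1].
pose B : set R := if e then `]2 ^- n.+1, 2 ^- n[%classic else `]1 - 2 ^- n, 1 - 2 ^- n.+1[%classic.
have -> : strip s e n = set_val @^-1` (normal s @^-1` A `&` tangent s @^-1` B).
  by apply/seteqP; split=> x; rewrite /strip /A /B; case: (e) => /=; rewrite in_itv.
apply: (@preimage_open R (normal s @^-1` A `&` tangent s @^-1` B)); apply: openI.
  apply: open_comp => [p _|]; first exact: cn.
  by rewrite /A; case: (e); [exact: open_gt|exact: open_lt].
apply: open_comp => [p _|]; first exact: ct.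
by rewrite /B; case: (e); exact: interval_open.
Qed.

Lemma strip_side s e n t : side_range n t -> strip s e n (to_polygon (side_point s e n t)).
Proof.
move=> nt; rewrite /strip /= to_polygonK; last exact: side_point_polygon.
case/andP: nt => t0 tn; have hn := halfS R n.
by case: s; case: e => /=; split; lra.
Qed.

Lemma strip_boundary s e n s' e' n' t : side_range n' t ->
  strip s e n (to_polygon (side_point s' e' n' t)) -> [/\ s' = s, e' = e & n' = n].
Proof.
move=> nt; rewrite /strip /= to_polygonK; last exact: side_point_polygon.
case/andP: nt => t0 tn; have [hn hn'] := (halfS R n, halfS R n').
have [ln pn] := (half_le1 R n, half_gt0 R n.+1).
have index : (2 ^- n'.+1 : R) < 2 ^- n -> (2 ^- n.+1 : R) < 2 ^- n' -> n' = n.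
  by move=> /half_lt nn' /half_lt; lia.
case: s; case: e; case: s'; case: e'; rewrite /= => -[? /andP[? ?]];
  solve [exfalso; lra | split=> //; apply: index; lra].
Qed.

Lemma strip_disjoint s n x : strip s false n x -> strip s true n x -> False.
Proof. by move=> [/= ? _] [/= ? _]; lra. Qed.

Lemma side_even x s n t e : side_range n t -> set_val x = side_point s e n t ->
  exists U, [/\ open U, U (surface x) & evenly_covered model_proj U].
Proof.
move=> nt xE; pose S := strip s false n `|` strip s true n.
have oS : open S by apply: openU; exact: strip_open.
have valE (z : @polygon R) q : set_val z = q -> z = to_polygon q.
  by move=> <-; rewrite to_polygon_val.
have S_glued s' e' n' t' z z' : side_range n' t' -> set_val z = side_point s' e' n' t' ->
    set_val z' = side_point s' (~~ e') n' t' -> S z -> S z'.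
  move=> nt' /valE -> /valE -> [|] /(strip_boundary nt')[es -> en]; rewrite /S -es -en;
    by [right; exact: strip_side|left; exact: strip_side].
have SE : @surface R @^-1` (@surface R @` S) = S.
  apply/seteqP; split=> z; last by exists z.
  move=> [z' Sz' /surfaceP[<- //|/gluedP[s' [n' [t' [nt' zE z'E]]]]|/gluedP[s' [n' [t' [nt' zE z'E]]]]]].
    exact: (S_glued s' false n' t' z').
  exact: (S_glued s' true n' t' z').
have SP z : (@surface R @` S) (surface z) <-> S z by rewrite -[X in _ <-> X z]SE.
have oU : open (@surface R @` S) by apply: surface_open; rewrite SE.
exists (@surface R @` S); split; [exact: oU| |].
  by apply/SP; rewrite (valE _ _ xE); case: e {xE}; [right|left]; exact: strip_side.
pose L := [set z : @polygon R | strip s false n z /\ open_square (set_val z)].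
(* On the low segment [cut] already equals the label; adding the label on the interior of the low
   strip makes the sum constant there, and it is 0 on the high strip. *)
pose f (u : chamanara R) : G := if `[< (@surface R @` L) u >] then label h s n else 0.
have fL z : L z -> f (surface z) = label h s n.
  by move=> Lz; rewrite /f; case: asboolP => // -[]; exists z.
have fN z : ~ L z -> f (surface z) = 0.
  move=> nLz; rewrite /f; case: asboolP => // -[z' Lz' /esym/(surface_interior Lz'.2) zz'].
  by case: nLz; rewrite zz'.
have fE z : S z -> cut z + f (surface z) = if `[< strip s false n z >] then label h s n else 0.
  move=> Sz; have [oz|nz] := pselect (open_square (set_val z)).
    rewrite (cut_interior oz) add0r; case: asboolP => sz; first by rewrite fL.
    by rewrite fN// => -[].
  rewrite fN; last by case.
  have [//|[s' [e' [n' [t' [nt' zE]]]]]] := (polygonP _).1 (polygon_val z).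
  rewrite addr0; case: Sz => sz; move: (sz); rewrite {1}(valE _ _ zE) =>
    /(strip_boundary nt')[es ee en]; rewrite es ee en in zE; rewrite en in nt'.
    by rewrite (cut_low nt' zE) asboolT.
  by rewrite (cut_high nt' zE) asboolF// => sz'; exact: strip_disjoint sz' sz.
apply: (@model_evenly_covered _ f) => // v.
have -> : [set z : @polygon R | (@surface R @` S) (surface z) /\ cut z + f (surface z) = v] =
    (if label h s n == v then strip s false n else set0) `|`
    (if 0 == v then strip s true n else set0).
  apply/seteqP; split=> z /=.
    move=> [/SP Sz]; rewrite fE//; case: asboolP => sz <-; first by left; rewrite eqxx.
    by right; rewrite eqxx; case: Sz.
  case; case: ifP => // /eqP <- sz.
    by split; [apply/SP; left|rewrite fE; [rewrite asboolT|left]].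
  split; [by apply/SP; right|rewrite fE; last by right].
  by rewrite asboolF// => sz'; exact: strip_disjoint sz' sz.
by apply: openU; case: ifP => _; (exact: strip_open || exact: open0).
Qed.

Lemma model_covering : is_covering model_proj.
Proof.
split; first exact: model_proj_continuous.
  by move=> y _; exists (0, y).
move=> y; have [x <-] := surface_onto y.
have [ox|[s [e [n [t [nt xE]]]]]] := (polygonP _).1 (polygon_val x).
  exact: interior_even.
exact: side_even nt xE.
Qed.

Lemma sheet_glue_low g s n : exists x x',
  sheet g x = sheet (g + label h s n) x'.
Proof.
have [_ _ _ glue _] := model_atlas.
by eexists; eexists; exact: (glue g s n _ (side_range_middle R n)).
Qed.

(** A set that is open and closed contains each copy of the polygon wholly or not at all, and the
    indices of the copies it contains are stable under adding labels. *)
Lemma model_connected :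
  (forall S : set G, S !=set0 -> (forall g s n, S g -> S (g + label h s n)) -> S = setT) ->
  connected [set: Y].
Proof.
move=> gen B [y0 By0] [C oC BC] [D cD BD].
have {oC BC} oB : open B by rewrite BC setTI.
have {cD BD} oBc : open (~` B) by rewrite BD setTI openC.
have sheetB g x : B (sheet g x) -> forall x', B (sheet g x').
  move=> Bx x'; suff : sheet g @^-1` B = setT by move=> BT; have : (sheet g @^-1` B) x' by rewrite BT.
  apply: (@polygon_connected R); first by exists x.
    by exists (sheet g @^-1` B); rewrite ?setTI//; exact: oB.
  by exists (sheet g @^-1` B); rewrite ?setTI// -openC; exact: oBc.
pose S := [set g | exists x, B (sheet g x)].
have ST : S = setT.
  apply: gen => [|g s n [x Bx]].
    by have [g [x gx]] := atlas_onto model_atlas y0; exists g, x; rewrite gx.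
  have [x1 [x2 x12]] := sheet_glue_low g s n; exists x2; rewrite -x12.
  exact: sheetB Bx _.
apply/seteqP; split=> // y _; have [g [x <-]] := atlas_onto model_atlas y.
have [x' Bx'] : S g by rewrite ST.
exact: sheetB Bx' _.
Qed.

Definition translate (a : G) (y : Y) : Y := (y.1 + a, y.2).

Lemma translate_continuous a : continuous (translate a).
Proof.
apply/continuousP => W oW; apply/model_openP => g; have := oW (g + a); congr open.
by apply/seteqP; split=> x; rewrite /translate /sheet /= addrAC.
Qed.

Lemma translate_deck a : deck model_proj (translate a).
Proof.
split=> //; first exact: translate_continuous.
exists (translate (- a)); split; first exact: translate_continuous.
  by move=> [g y]; rewrite /translate /= addrK.
by move=> [g y]; rewrite /translate /= subrK.
Qed.

(** By unique lifting a deck transformation is determined by the image of one point, and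
    translations already reach the whole fibre. *)
Lemma deck_translate f : connected [set: Y] -> deck model_proj f -> exists a, f = translate a.
Proof.
move=> cY [cf _ pf]; pose y0 : Y := (0, base_point R).
exists (f y0).1; apply/funext.
apply: (unique_lifting model_covering cY cf (@translate_continuous _) (z0 := y0)).
  by move=> y; rewrite pf.
by rewrite /translate /= add0r {1}(surjective_pairing (f y0)); congr pair; exact: pf.
Qed.

Lemma model_finite_abelian_cover : connected [set: Y] -> is_finite_abelian_cover model_proj.
Proof.
move=> cY; split.
- split; first by split=> //; exact: model_covering.
  move=> [g y] [g' y'] /= yy'; exists (translate (g' - g)); first exact: translate_deck.
  by rewrite /translate /= addrC subrK -[y']yy'.
- apply: (@sub_finite_set _ _ (range translate)).
    by move=> f /(deck_translate cY)[a ->]; exists a.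
  exact/finite_image/finite_finset.
- move=> f f' /(deck_translate cY)[a ->] /(deck_translate cY)[b ->].
  by apply/funext => y; rewrite /translate /= addrAC.
Qed.

End Model.

Section CyclicModel.
Variables (R : realType) (n : nat).

Let one : 'I_n.+1 := inZp 1.

Lemma ord_mulrn_one (g : 'I_n.+1) : g = one *+ g.
Proof.
have onek k : one *+ k = inZp k :> 'I_n.+1.
  elim: k => [|k IH]; first by apply: val_inj; rewrite /= mod0n.
  by rewrite mulrS IH; apply: val_inj; rewrite /= modnDml modnDmr add1n.
by rewrite onek valZpK.
Qed.

(* All labels other than those of [alpha 1] and [beta 1] vanish, and these two
   cancel in the alternating sum. *)
Definition cyclic_vector (i : int) : 'I_n.+1 :=
  if i == 1 then one else if i == -1 then - one else 0.

Lemma cyclic_model : exists (Y : topologicalType) (p : Y -> chamanara R),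
  is_finite_abelian_cover p /\ has_n_ends n.+1 Y.
Proof.
exists (labelled_model R cyclic_vector), (@model_proj R _ cyclic_vector); split.
  apply/model_finite_abelian_cover/model_connected => S [g Sg] gen.
  have Sk k : S (g + one *+ k).
    elim: k => [|k IH]; first by rewrite addr0.
    (* The label of the first vertical segment is [one], which generates the group. *)
    by rewrite mulrSr addrA; exact: (gen _ false 0%N IH).
  apply/seteqP; split=> // g' _; have := Sk (g' - g).
  by rewrite -ord_mulrn_one addrC subrK.
rewrite -[X in has_n_ends X](card_ord n.+1).
apply: (condition_ends (model_atlas R cyclic_vector)) => //.
exists 2 => //; split.
  rewrite !big_ord_recl big_ord0 /cyclic_vector /=.
  have -> : (-1 : int) ^ ((bump 0 0)%:Z - 2) = -1 by [].
  have -> : (-1 : int) ^ ((bump 0 (bump 0 (bump 0 0)))%:Z - 2) = -1 by [].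
  by rewrite !mul0rz !mulrNz !mulr1z opprK !add0r addr0 subrr.
by move=> [|[|m]].
Qed.

End CyclicModel.

(** * The theorem *)

Theorem proposition8p1 (R : realType) (d : nat) (hd : (0 < d)%N) :
  (exists (Y : topologicalType) (p : Y -> chamanara R),
     is_finite_abelian_cover p /\ has_n_ends d Y) /\
  (forall (G : finZmodType) (h : int -> G),
     #|G| = d -> defining_vector h ->
     forall (Y : topologicalType) (p : Y -> chamanara R),
       is_cover_of_vector h p ->
       (has_n_ends d Y <->
        exists2 N : nat, (0 < N)%N &
          \sum_(j < N.*2) h (j%:Z - N%:Z) *~ ((-1) ^ (j%:Z - N%:Z)) = 0 /\
          forall n : nat, (N <= n)%N ->
            [/\ h (- n%:Z) = h (- N%:Z), h (- N%:Z) = h N%:Z &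
                h N%:Z = h n%:Z])).
Proof.
split; first by case: d hd => // d' _; exact: cyclic_model.
move=> G h <- hP Y p coverp; have [Phi atlas] := vector_cover_atlas hP coverp.
have [_ h0] := hP.
by split=> [/(ends_condition atlas h0)|/(condition_ends atlas h0)].
Qed.
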